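(* Let $\kappa^1,\kappa^2$ be skew diagrams with $|\kappa^1|=|\kappa^2|=N$, and let $\lambda^i\subset\nu^i$ ($i=1,2$) be Young diagrams with $\kappa^i=\nu^i\setminus\lambda^i$. Then the maps $\mathcal S_1,\mathcal S_2,\mathcal S_3$ defined in the context give bijections $$\mathbf P(\kappa^1,\kappa^2)\xrightarrow{\ \mathcal S_1\ }\mathbf S(\kappa^1,\kappa^2)\xrightarrow{\ \mathcal S_2\ }\mathbf W(\kappa^1,\kappa^2)\xrightarrow{\ \mathcal S_3\ }\coprod_{\mu}\left(\mathbf B(\mu)^{\nu^1}_{\lambda^1}\times\mathbf B(\mu)^{\nu^2}_{\lambda^2}\right),$$ where $\mu$ runs over the Young diagrams with $|\mu|=N$.
   Context: Diagrams and tableaux. Boxes of (skew) Young diagrams are identified with points $(i,j)\in\mathbb N\times\mathbb N$ ($i$ = row, counted from the top; $j$ = column, counted from the left). A skew diagram $\kappa=\nu\setminus\lambda$ ($\lambda\subset\nu$ Young diagrams) is the set-theoretic difference; $|\kappa|$ is its number of boxes and $\kappa_i=\nu_i-\lambda_i$ its number of boxes in row $i$. Fix $n$ such that all given Young diagrams have at most $n$ rows. (Skew) Young tableaux are semistandard (rows weakly increasing left to right, columns strictly increasing downwards) with entries in $\{1,\dots,n+1\}$; $S_{i,j}$ is the entry of $S$ in box $(i,j)$. $\mathbf B(\mu)$ is the set of Young tableaux of shape $\mu$. Pictures. On subsets of $\mathbb N\times\mathbb N$: $(a,b)\leqslant_P(c,d)$ iff $a\le c$ and $b\le d$; $(a,b)\leqslant_J(c,d)$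 iff $a<c$, or $a=c$ and $b\ge d$. A map $f:X\to Y$ is PJ-standard if $x\leqslant_P x'$ implies $f(x)\leqslant_J f(x')$. A picture is a bijection $f$ such that $f$ and $f^{-1}$ are PJ-standard. $\mathbf P(\kappa^1,\kappa^2)$ is the set of pictures $\kappa^1\to\kappa^2$. Reading and additions. The middle-eastern reading $ME(S)=i_1\otimes\cdots\otimes i_N$ of a (skew) tableau $S$ lists its entries row by row from top to bottom, each row read from right to left. For a Young diagram $\lambda$, $\lambda[i]$ is obtained from $\lambda$ by increasing $\lambda_i$ by 1 (possibly not a Young diagram), and $\lambda[i_1,\dots,i_k]=(\cdots(\lambda[i_1])\cdots)[i_k]$. Littlewood-Richardson crystal. $\mathbf B(\mu)^\nu_\lambda$ is the set of $T\in\mathbf B(\mu)$ such that, writing $ME(T)=i_1\otimes\cdots\otimes i_N$, $\lambda[i_1,\dots,i_k]$ is a Young diagram for every $k=1,\dots,N$ and $\lambda[i_1,\dots,i_N]=\nu$. Column bumping $x\to T$. If all entries of the first column of $T$ are smaller than $x$, put $x$ at the bottom of that column and stop. Otherwise let $y$ be the topmost entry of that column with $y\ge x$; replace $y$ by $x$, and insert $y$ in the same way into the second column, and so on; if one passes the last column, create a new column consisting of the bumped entry. The shape grows by one box, the new box $\mathrm{New}(x)$. For a two-rowed array $w=\binom{w^1}{w^2}=\binom{b_1\cdots b_N}{a_1\cdots a_N}$, the column bumping of $w^2$ is $T^2=a_N\to(\cdots(a_2\to a_1))$, and the recording tableau by $w^1$ is the filling of the same shape with $b_k$ in the box $\mathrm{New}(a_k)$.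 The array $w$ is lexicographic (of column type) if $b_1\le\cdots\le b_N$ and $b_k=b_{k+1}$ implies $a_k\ge a_{k+1}$. Intermediate sets. $\mathbf S(\kappa^1,\kappa^2)$ is the set of skew tableaux $S$ of shape $\kappa^1$ in which the number of entries equal to $i$ is $\kappa^2_i$ for all $i$, and such that, writing $ME(S)=i_1\otimes\cdots\otimes i_N$, $\lambda^2[i_1,\dots,i_k]$ is a Young diagram for $k=1,\dots,N$ and $\lambda^2[i_1,\dots,i_N]=\nu^2$. $\mathbf W(\kappa^1,\kappa^2)$ is the set of lexicographic two-rowed arrays $w=\binom{w^1}{w^2}$ of length $N$ in which $i$ occurs $\kappa^j_i$ times in $w^j$ ($j=1,2$), and such that for some Young diagram $\mu$ the column bumping of $w^2$ is in $\mathbf B(\mu)^{\nu^2}_{\lambda^2}$ and the recording tableau by $w^1$ is in $\mathbf B(\mu)^{\nu^1}_{\lambda^1}$. Maps. - $\mathcal S_1$: for a picture $f=(f_1,f_2)$ (row and column coordinates), $\mathcal S_1(f)$ is the filling $S$ of $\kappa^1$ with $S_{i,j}=f_1(i,j)$. - $\mathcal S_2$: if $ME(S)=a_1\otimes\cdots\otimes a_N$ and $b_i$ is the row number of the box of $S$ containing (this occurrence of) $a_i$, then $\mathcal S_2(S)=\binom{b_1\cdots b_N}{a_1\cdots a_N}$. - $\mathcal S_3$: $\mathcal S_3(w)=(T^1,T^2)$ with $T^2$ the column bumping of $w^2$ and $T^1$ the recording tableau by $w^1$. *)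

(* Defs.v *)
From mathcomp Require Import all_boot.
From mathcomp Require Import finmap.
From mathcomp Require Import boolp classical_sets functions.

Set Implicit Arguments.
Unset Strict Implicit.
Unset Printing Implicit Defensive.

Local Open Scope fset_scope.
Local Open Scope classical_set_scope.

(* Rows, columns and tableau entries are all numbered from 0: the row (or
   entry) written i here is the row (or entry) i + 1 of the usual numbering.
   The entries {1, ..., n + 1} thus become {0, ..., n}. *)

(* A Young diagram is the sequence of its nonzero row lengths, so that equal
   diagrams are equal sequences; row i has length [nth 0 la i]. *)
Definition is_young (la : seq nat) : bool := sorted geq la && (0 \notin la).

Definition incl_young (la nu : seq nat) : Prop :=
  forall i, nth 0 la i <= nth 0 nu i.

Definition diagram (la : seq nat) : {fset nat * nat} :=
  [fset x in [seq (i, j) | i <- iota 0 (size la), j <- iota 0 (nth 0 la i)]].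

Definition skew (la nu : seq nat) : {fset nat * nat} :=
  (diagram nu `\` diagram la)%fset.

Definition skew_row (la nu : seq nat) (i : nat) : nat := nth 0 nu i - nth 0 la i.

Definition leP (x y : nat * nat) : bool := (x.1 <= y.1) && (x.2 <= y.2).

Definition leJ (x y : nat * nat) : bool :=
  (x.1 < y.1) || (x.1 == y.1) && (y.2 <= x.2).

Definition PJ_standard (X Y : {fset nat * nat}) (f : X -> Y) : Prop :=
  forall x x' : X, leP (val x) (val x') -> leJ (val (f x)) (val (f x')).

Definition pictures (X Y : {fset nat * nat}) : set {ffun X -> Y} :=
  [set f | exists g : Y -> X,
     [/\ cancel f g, cancel g f, PJ_standard f & PJ_standard g]].

Arguments pictures : clear implicits.

Notation filling X := {ffun (X : {fset nat * nat}) -> nat}.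

Definition is_tableau (n : nat) (X : {fset nat * nat}) (T : filling X) : Prop :=
  [/\ forall x : X, T x <= n,
      forall x y : X, (val x).1 = (val y).1 -> (val x).2 <= (val y).2 ->
        T x <= T y
    & forall x y : X, (val x).2 = (val y).2 -> (val x).1 < (val y).1 ->
        T x < T y].

(* [leJ] is a total order listing the rows from top to bottom, each from right
   to left: it is the order of the middle-eastern reading. *)
Definition ME_boxes (X : {fset nat * nat}) : seq X :=
  sort (fun x y : X => leJ (val x) (val y)) (enum {: X}).

Definition ME (X : {fset nat * nat}) (T : filling X) : seq nat :=
  [seq T x | x <- ME_boxes X].

(* la[i_1, ..., i_k]; [incr_nth] pads with zeros, and then the result is not
   a Young diagram in the sense of [is_young] as soon as a row was skipped. *)
Definition add_boxes (la : seq nat) (s : seq nat) : seq nat :=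
  foldl incr_nth la s.

Definition LR_word (la nu : seq nat) (s : seq nat) : Prop :=
  (forall k, 0 < k <= size s -> is_young (add_boxes la (take k s)))
  /\ add_boxes la s = nu.

Definition LR_crystal (n : nat) (mu la nu : seq nat) :
    set (filling (diagram mu)) :=
  [set T | is_tableau n T /\ LR_word la nu (ME T)].

Arguments LR_crystal : clear implicits.

Definition LR_skew_tableaux (n : nat) (X : {fset nat * nat})
    (la2 nu2 : seq nat) : set (filling X) :=
  [set S | [/\ is_tableau n S,
               forall i, count_mem i (ME S) = skew_row la2 nu2 i
             & LR_word la2 nu2 (ME S)]].

Arguments LR_skew_tableaux : clear implicits.

(* For column bumping a tableau is given by the sequence of its columns, from
   left to right, each listed from top to bottom. *)
Fixpoint col_insert (x : nat) (T : seq (seq nat)) : seq (seq nat) :=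
  if T is c :: T' then
    if all (fun y => y < x) c then rcons c x :: T'
    else let k := find (fun y => x <= y) c in
         set_nth 0 c k x :: col_insert (nth 0 c k) T'
  else [:: [:: x]].

Fixpoint new_box (x : nat) (T : seq (seq nat)) : nat * nat :=
  if T is c :: T' then
    if all (fun y => y < x) c then (size c, 0)
    else let: (i, j) := new_box (nth 0 c (find (fun y => x <= y) c)) T' in
         (i, j.+1)
  else (0, 0).

Definition col_bumping (s : seq nat) : seq (seq nat) :=
  foldl (fun T x => col_insert x T) [::] s.

Fixpoint new_boxes (T : seq (seq nat)) (s : seq nat) : seq (nat * nat) :=
  if s is x :: s' then new_box x T :: new_boxes (col_insert x T) s' else [::].

(* Row i has one box for each column of length greater than i. *)
Definition shape_of (T : seq (seq nat)) : seq nat :=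
  mkseq (fun i => count (fun c => i < size c) T) (size (head [::] T)).

Definition bumping_filling (mu : seq nat) (s : seq nat) : filling (diagram mu) :=
  [ffun x => nth 0 (nth [::] (col_bumping s) (val x).2) (val x).1].

Definition recording_filling (mu : seq nat) (r s : seq nat) :
    filling (diagram mu) :=
  [ffun x => nth 0 r (index (val x) (new_boxes [::] s))].

Definition pair_fillings (mu : seq nat) : Type :=
  (filling (diagram mu) * filling (diagram mu))%type.

(* A two-rowed array is the sequence of its columns (b_k, a_k). *)
Definition lexicographic (w : seq (nat * nat)) : bool :=
  sorted (fun p q => (p.1 <= q.1) && ((p.1 == q.1) ==> (q.2 <= p.2))) w.

Definition S1 (X Y : {fset nat * nat}) (f : {ffun X -> Y}) : filling X :=
  [ffun x => (val (f x)).1].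

Definition S2 (X : {fset nat * nat}) (S : filling X) : seq (nat * nat) :=
  [seq ((val x).1, S x) | x <- ME_boxes X].

Definition S3 (w : seq (nat * nat)) : {mu : seq nat & pair_fillings mu} :=
  let mu := shape_of (col_bumping (unzip2 w)) in
  existT pair_fillings mu
    (recording_filling mu (unzip1 w) (unzip2 w), bumping_filling mu (unzip2 w)).

Definition arrays (n N : nat) (la1 nu1 la2 nu2 : seq nat) :
    set (seq (nat * nat)) :=
  [set w | [/\ size w = N, lexicographic w,
               forall i, count_mem i (unzip1 w) = skew_row la1 nu1 i
                         /\ count_mem i (unzip2 w) = skew_row la2 nu2 i
             & exists (mu : seq nat) (T1 T2 : filling (diagram mu)),
                 [/\ is_young mu, S3 w = existT pair_fillings mu (T1, T2),
                     LR_crystal n mu la2 nu2 T2 & LR_crystal n mu la1 nu1 T1]]].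

Definition LR_pairs (n N : nat) (la1 nu1 la2 nu2 : seq nat) :
    set {mu : seq nat & pair_fillings mu} :=
  [set T | [/\ is_young (projT1 T), sumn (projT1 T) = N,
               LR_crystal n (projT1 T) la1 nu1 (projT2 T).1
             & LR_crystal n (projT1 T) la2 nu2 (projT2 T).2]].

(* Main.v *)
(** A filling [S] of [kappa1] with weakly increasing rows is the same as a
lexicographic array [w] with the row numbers of [kappa1] on top.  Let [w'] be
[w] with its two rows exchanged, sorted again.  The columns of [S] are strict
if and only if the second row of [w'] is a Littlewood-Richardson word from
[la1] to [nu1]: both amount to
  la1_(i+1) + #{x in row i+1 | S x <= a} <= la1_i + #{x in row i | S x < a}
for all [i] and [a].  Column bumping transforms a word by Knuth relations,
which preserve Littlewood-Richardson words, so the condition on the second row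
of [w] says that the bumping tableau [P w] lies in the crystal for
[kappa2]; since the recording tableau [Q w] equals [P w'], the condition on the
second row of [w'] says that [Q w] lies in the one for [kappa1].  The symmetry
[Q w = P w'] follows by peeling off the first column of both tableaux, and the
Robinson-Schensted-Knuth correspondence does the rest.  A picture [f] is
recovered from [S] because [f x] is the box that the letter of [x] adds in the
middle-eastern reading of [S]. *)

Require Import Defs.
From mathcomp Require Import all_boot.
From mathcomp Require Import finmap.
From mathcomp Require Import boolp classical_sets functions.
From mathcomp Require Import zify.

Set Implicit Arguments.
Unset Strict Implicit.
Unset Printing Implicit Defensive.

(** Knuth equivalence enters only through what it preserves: content, and dominance from every
    dominant starting function. The elementary relations preserve dominance because adding boxes in
    two rows commutes unless the rows are adjacent, and then the third letter settles the matter.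

    The obstacle in the symmetry is that exchanging the two rows reorders the array: the last point
    of [w'] stands somewhere in the middle of [w]. One must therefore know how a point inserted in
    the middle changes the first columns and the array of bumped entries. This is tractable because
    the point exceeds all earlier ones strictly in both coordinates and its letter is at least every
    later one. The array of bumped entries plays the part of the skeleton in Viennot's shadow
    construction.

    The counting inequality shared by the two conditions comes from the order inside a block of
    equal top labels: the letters [i + 1] precede the letters [i], so row [i + 1] is most at risk
    between the two. *)

(** * Littlewood-Richardson words and Knuth relations *)

(* The word conditions are stated for the function of row lengths of a
   diagram, which avoids the padding and trailing zeros of sequences. *)
Definition add_at (f : nat -> nat) (i : nat) : nat -> nat :=
  fun j => f j + (j == i).

Definition dominant (f : nat -> nat) : Prop := forall i, f i.+1 <= f i.

Fixpoint dominant_word (f : nat -> nat) (s : seq nat) : bool :=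
  if s is i :: s' then
    ((i == 0) || (f i < f i.-1)) && dominant_word (add_at f i) s'
  else true.

Lemma eq_dominant_word f g s : f =1 g -> dominant_word f s = dominant_word g s.
Proof.
elim: s f g => //= i s IHs f g fg; rewrite !fg (IHs _ (add_at g i)) // => j.
by rewrite /add_at fg.
Qed.

Lemma dominant_add f i :
  dominant f -> (i == 0) || (f i < f i.-1) -> dominant (add_at f i).
Proof.
move=> df hi j; have := df j; rewrite /add_at.
case: (eqVneq j.+1 i) hi => [<- /=|_ _]; last by lia.
by case: (j == j.+1) => /=; lia.
Qed.

Lemma dominant_word_cat f s t :
  dominant_word f (s ++ t) =
  dominant_word f s && dominant_word (fun j => f j + count_mem j s) t.
Proof.
elim: s f => [|i s IHs] f /=.
  by apply: eq_dominant_word => j; rewrite addn0.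
rewrite IHs andbA; congr (_ && _); apply: eq_dominant_word => j.
by rewrite /add_at addnA eq_sym.
Qed.

Lemma dominant_word_dominant f s :
  dominant f -> dominant_word f s -> dominant (fun j => f j + count_mem j s).
Proof.
elim: s f => [|i s IHs] f df /=; first by move=> _ j; rewrite !addn0.
case/andP=> hi hs j; have := IHs _ (dominant_add df hi) hs j.
by rewrite /add_at /= ![i == _]eq_sym; lia.
Qed.

Lemma dominant_leq f i j : dominant f -> i <= j -> f j <= f i.
Proof.
move=> df; elim: j => [|j IHj]; first by rewrite leqn0 => /eqP->.
by rewrite leq_eqVlt => /predU1P[->//|/IHj]; apply: leq_trans.
Qed.

Lemma sorted_ltn_rcons c x :
  sorted ltn (rcons c x) = all (fun y => y < x) c && sorted ltn c.
Proof.
rewrite !(sorted_pairwise ltn_trans) -cats1 pairwise_cat allrel1r /=.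
by rewrite andbT.
Qed.

(** Quantifying over all dominant [f] makes this a congruence: a prefix only replaces [f] by another
    dominant function. *)
Definition LR_equiv (s t : seq nat) : Prop :=
  perm_eq s t /\ forall f, dominant f -> dominant_word f s = dominant_word f t.

Lemma LR_equiv_sym s t : LR_equiv s t -> LR_equiv t s.
Proof. by case=> p e; split=> [|f /e->//]; rewrite perm_sym. Qed.

Lemma LR_equiv_trans t s u :
  LR_equiv s t -> LR_equiv t u -> LR_equiv s u.
Proof.
move=> [p e] [p' e']; split=> [|f df]; first exact: perm_trans p'.
by rewrite e ?e'.
Qed.

Lemma LR_equiv_cat u s t v :
  LR_equiv s t -> LR_equiv (u ++ s ++ v) (u ++ t ++ v).
Proof.
move=> [p e]; split=> [|f df]; first by rewrite perm_cat2l perm_cat2r.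
rewrite !dominant_word_cat; case hu: (dominant_word f u) => //=.
rewrite e; last exact: dominant_word_dominant.
congr (_ && _); apply: eq_dominant_word => j.
by rewrite (permP p).
Qed.

Lemma LR_equiv_catl u s t : LR_equiv s t -> LR_equiv (u ++ s) (u ++ t).
Proof. by move/(@LR_equiv_cat u _ _ [::]); rewrite !cats0. Qed.

Lemma LR_equiv_catr v s t : LR_equiv s t -> LR_equiv (s ++ v) (t ++ v).
Proof. exact: (@LR_equiv_cat [::]). Qed.

(** The letters [x] and [z] interact only if [z = x + 1]. Then [y = x], and the box already added in
    row [x] makes room for [z] in either order. *)
Lemma knuth_yzx x y z : x <= y < z -> LR_equiv [:: y; z; x] [:: y; x; z].
Proof.
move=> xyz; split=> [|f df].
  by rewrite perm_cons (perm_catC [:: z] [:: x]).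
rewrite /= /add_at; have [zx xy] : z != x /\ x.-1 != z by lia.
case: (eqVneq z.-1 x) => [e|]; last first.
  by have := df x.-1; case: x y z xyz zx xy => [|x] [|y] [|z] //=; lia.
have -> : y = x by lia.
have -> : z = x.+1 by lia.
by rewrite /= !eqxx; have := df x; case: x {e xyz zx xy} => [|x] //=; lia.
Qed.

(** The letters [w] and [y] interact only if [y = w + 1]. Then [x = y], and the two boxes in row
    [w + 1] against one in row [w] force [f w.+1 < f w] in either order. *)
Lemma knuth_wyx w x y : w < x <= y -> LR_equiv [:: w; y; x] [:: y; w; x].
Proof.
move=> xyz; split=> [|f df].
  by rewrite -[[:: w; y; x]]/([:: w; y] ++ [:: x])
     -[[:: y; w; x]]/([:: y; w] ++ [:: x]) perm_cat2r (perm_catC [:: w] [:: y]).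
rewrite /= /add_at; case: (eqVneq y.-1 w) => [e|].
  have -> : x = w.+1 by lia.
  have -> : y = w.+1 by lia.
  have := df w; case: w {e xyz} => [|w] /=; lia.
by have := df y.-1; case: w x y xyz => [|x] [|y] [|z] //=; lia.
Qed.

(** The letter [y] moves left through [c] by [knuth_wyx]; the letter just passed serves as the third
    letter of the next move. *)
Lemma LR_equiv_col c x y : sorted ltn c -> all (fun z => z < x) c -> x <= y ->
  LR_equiv (c ++ [:: y; x]) (y :: c ++ [:: x]).
Proof.
elim/last_ind: c x => [|c z IHc] x //=.
rewrite sorted_ltn_rcons all_rcons => /andP[hcz hsc] /andP[zx cx] xy.
rewrite -cats1 -!catA /=.
apply: (@LR_equiv_trans (c ++ [:: y; z; x])).
  by apply: LR_equiv_catl; apply: knuth_wyx; rewrite zx.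
have := LR_equiv_catr [:: x] (IHc z hsc hcz _).
rewrite -!catA /= -catA; apply; lia.
Qed.

(** * Column insertion *)

Definition insert_pos (x : nat) (c : seq nat) : nat := find (fun y => x <= y) c.

Lemma all_ltn_insert_pos x c :
  all (fun y => y < x) c = (insert_pos x c == size c).
Proof.
rewrite /insert_pos -[RHS]negbK neq_ltn [size c < _]ltnNge find_size orbF -has_find -all_predC.
by apply: eq_all => y /=; rewrite ltnNge.
Qed.

Lemma insert_pos_bump x c :
  ~~ all (fun y => y < x) c -> insert_pos x c < size c.
Proof. by rewrite all_ltn_insert_pos ltn_neqAle => ->; apply: find_size. Qed.

Lemma nth_insert_pos x c :
  insert_pos x c < size c -> x <= nth 0 c (insert_pos x c).
Proof. by rewrite -has_find => /(nth_find 0). Qed.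

Lemma nth_lt_insert_pos x c i : i < insert_pos x c -> nth 0 c i < x.
Proof. by move=> hi; rewrite ltnNge (before_find 0 hi). Qed.

Lemma insert_pos_leq x c i : i < size c -> x <= nth 0 c i -> insert_pos x c <= i.
Proof.
by move=> hi hx; rewrite leqNgt; apply/negP=> /nth_lt_insert_pos; rewrite ltnNge hx.
Qed.

Lemma set_nth_split (T : Type) (x0 : T) s k x : k < size s ->
  set_nth x0 s k x = take k s ++ x :: drop k.+1 s.
Proof. by elim: s k => [|y s IHs] [|k] //= hk; rewrite ?drop0 ?IHs. Qed.

Lemma col_split k (c : seq nat) : k < size c ->
  c = take k c ++ nth 0 c k :: drop k.+1 c.
Proof. by move=> hk; rewrite -drop_nth // cat_take_drop. Qed.

(** The letter [x] moves left through [c] by [knuth_yzx], each time with the preceding entry of the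
    column as witness. *)
Lemma LR_equiv_row y c x : sorted ltn (y :: c) -> x <= y ->
  LR_equiv (y :: c ++ [:: x]) (y :: x :: c).
Proof.
elim: c y => [|z c IHc] y //= /andP[yz sc] xy.
apply: (@LR_equiv_trans [:: y, z, x & c]).
  by apply: (@LR_equiv_catl [:: y]); apply: IHc => //; lia.
by apply: (@LR_equiv_catr c [:: y; z; x] [:: y; x; z]); apply: knuth_yzx; lia.
Qed.

(** The letter [x] first travels left until it stands right after the entry that it bumps; that
    entry then travels left past the entries above it, all smaller than [x]. *)
Lemma LR_equiv_bump x c (k := insert_pos x c) : sorted ltn c -> k < size c ->
  LR_equiv (c ++ [:: x]) (nth 0 c k :: set_nth 0 c k x).
Proof.
move=> sc hk; rewrite set_nth_split // {1}(col_split hk).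
have sd : sorted ltn (nth 0 c k :: drop k.+1 c).
  by rewrite -drop_nth //; apply: drop_sorted.
have hx : x <= nth 0 c k by apply: nth_insert_pos.
rewrite -catA /=; apply: LR_equiv_trans.
  by apply: LR_equiv_catl; apply: LR_equiv_row.
have := @LR_equiv_col (take k c) x (nth 0 c k) _ _ hx.
move/(_ (take_sorted _ sc)) => h.
suff: LR_equiv ((take k c ++ [:: nth 0 c k; x]) ++ drop k.+1 c)
  ((nth 0 c k :: take k c ++ [:: x]) ++ drop k.+1 c) by rewrite -catA /= -catA.
apply: LR_equiv_catr; apply: h; apply/(all_nthP 0) => i; rewrite size_take hk => ik.
by rewrite nth_take //; apply: nth_lt_insert_pos.
Qed.

(** Columns are read from right to left, so that the first column, which receives an inserted
    letter, stands next to a letter appended to the word. *)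
Definition column_word (T : seq (seq nat)) : seq nat := flatten (rev T).

Lemma column_word_cons c T : column_word (c :: T) = column_word T ++ c.
Proof. by rewrite /column_word rev_cons flatten_rcons. Qed.

(* Unlike in [col_insert], the two cases agree on the first column: [set_nth]
   at position [size c] appends. *)
Definition ins_col (x : nat) (c : seq nat) : seq nat :=
  set_nth 0 c (insert_pos x c) x.

Lemma ins_col_rcons x c : all (fun y => y < x) c -> ins_col x c = rcons c x.
Proof.
by rewrite all_ltn_insert_pos /ins_col => /eqP->; elim: c => //= y c ->.
Qed.

Lemma col_insert_cons x c T : col_insert x (c :: T) =
  ins_col x c :: if all (fun y => y < x) c then T
                 else col_insert (nth 0 c (insert_pos x c)) T.
Proof.
by rewrite /=; case: ifPn => // h; rewrite ins_col_rcons.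
Qed.

Lemma LR_equiv_col_insert x T : all (sorted ltn) T ->
  LR_equiv (column_word T ++ [:: x]) (column_word (col_insert x T)).
Proof.
elim: T x => [|c T IHT] x //= /andP[sc sT].
rewrite column_word_cons; case: ifPn => [h|/insert_pos_bump h].
  by rewrite column_word_cons -catA cats1.
rewrite column_word_cons -catA -/(insert_pos x c).
apply: LR_equiv_trans (LR_equiv_catl _ (LR_equiv_bump sc h)) _.
rewrite -cat1s catA; apply: LR_equiv_catr.
exact: IHT.
Qed.

Lemma sorted_ins_col x c : sorted ltn c -> sorted ltn (ins_col x c).
Proof.
move=> sc; case: (boolP (all (fun y => y < x) c)) => [h|/insert_pos_bump h].
  by rewrite ins_col_rcons // sorted_ltn_rcons h.
apply/(sortedP 0) => i; rewrite size_set_nth (maxn_idPr h) => hi.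
have /(sortedP 0)/(_ i hi) hs := sc.
rewrite !nth_set_nth /=; case: (eqVneq i (insert_pos x c)) => [e|ne].
  have := nth_insert_pos h; rewrite -e in h *.
  by case: eqP; lia.
case: (eqVneq i.+1 (insert_pos x c)) => // e.
by apply: nth_lt_insert_pos; rewrite -e.
Qed.

Lemma sorted_col_insert x T :
  all (sorted ltn) T -> all (sorted ltn) (col_insert x T).
Proof.
elim: T x => [|c T IHT] x // /andP[sc sT].
rewrite col_insert_cons /= sorted_ins_col //=; case: ifP => // _; exact: IHT.
Qed.

Lemma col_bumping_rcons s x :
  col_bumping (rcons s x) = col_insert x (col_bumping s).
Proof. by rewrite /col_bumping -cats1 foldl_cat. Qed.

Lemma sorted_col_bumping s : all (sorted ltn) (col_bumping s).
Proof.
elim/last_ind: s => // s x IHs; rewrite col_bumping_rcons.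
exact: sorted_col_insert.
Qed.

Lemma LR_equiv_col_bumping s : LR_equiv s (column_word (col_bumping s)).
Proof.
elim/last_ind: s => // s x IHs; rewrite col_bumping_rcons -cats1.
apply: LR_equiv_trans (LR_equiv_catr _ IHs) _.
exact/LR_equiv_col_insert/sorted_col_bumping.
Qed.

(** * Semistandard tableaux as lists of columns *)

Definition col_le (c d : seq nat) : bool :=
  (size d <= size c) && all (fun i => nth 0 c i <= nth 0 d i) (iota 0 (size d)).

Lemma col_leP c d :
  reflect (size d <= size c /\ forall i, i < size d -> nth 0 c i <= nth 0 d i)
          (col_le c d).
Proof.
apply: (iffP andP) => -[h1 h2]; split=> //.
  by move=> i hi; apply: (allP h2); rewrite mem_iota.
by apply/allP => i; rewrite mem_iota; apply: h2.
Qed.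

Lemma col_le_trans : transitive col_le.
Proof.
move=> d c e /col_leP[s1 h1] /col_leP[s2 h2]; apply/col_leP; split.
  exact: leq_trans s1.
by move=> i hi; apply: leq_trans (h2 i hi); apply: h1; apply: leq_trans s2.
Qed.

(** Empty columns are excluded so that a tableau has only one list of columns and the list of column
    lengths contains no zero. *)
Definition col_tableau (T : seq (seq nat)) : bool :=
  all (fun c => sorted ltn c && (c != [::])) T && sorted col_le T.

Lemma col_tableau_cons c T : col_tableau (c :: T) =
  [&& sorted ltn c, c != [::], col_tableau T & all (col_le c) T].
Proof.
rewrite /col_tableau /= (path_sortedE col_le_trans) -!andbA.
by do !bool_congr.
Qed.

Lemma col_tableau_sorted T : col_tableau T -> all (sorted ltn) T.
Proof. by case/andP=> h _; apply: sub_all h => c /andP[]. Qed.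

Lemma col_ltn_nth c i j : sorted ltn c -> j < size c -> i < j ->
  nth 0 c i < nth 0 c j.
Proof.
by move=> sc hj ij; apply: (path.sorted_ltn_nth ltn_trans 0 sc) => //;
  rewrite inE //; apply: ltn_trans hj.
Qed.

Lemma col_leq_nth c i j : sorted ltn c -> j < size c -> i <= j ->
  nth 0 c i <= nth 0 c j.
Proof.
move=> sc hj; rewrite leq_eqVlt => /predU1P[->//|ij].
exact/ltnW/col_ltn_nth.
Qed.

Lemma size_ins_col x c : size c <= size (ins_col x c).
Proof. by rewrite /ins_col size_set_nth leq_maxr. Qed.

Lemma size_ins_col_bump x c : ~~ all (fun y => y < x) c ->
  size (ins_col x c) = size c.
Proof. by move/insert_pos_bump=> h; rewrite /ins_col size_set_nth (maxn_idPr h). Qed.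

Lemma nth_ins_col x c i : nth 0 (ins_col x c) i =
  if i == insert_pos x c then x else nth 0 c i.
Proof. by rewrite /ins_col nth_set_nth. Qed.

Lemma col_le_rcons c d x : col_le c d -> col_le (rcons c x) d.
Proof.
move=> /col_leP[h1 h2]; apply/col_leP; rewrite size_rcons; split; first by lia.
move=> i hi; rewrite nth_rcons; case: ifP => [_|]; first exact: h2.
by move: (leq_trans hi h1) => ->.
Qed.

(* The entry bumped from row [k] of [c] lands in [d] in a row [<= k], since
   the entry of [d] in row [k], if any, is at least as large. *)
Lemma col_le_bump x c d (k := insert_pos x c) :
  sorted ltn c -> ~~ all (fun y => y < x) c -> col_le c d ->
  col_le (ins_col x c) (ins_col (nth 0 c k) d).
Proof.
move=> sc hb /col_leP[h1 h2]; set y := nth 0 c k.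
have hk : k < size c by apply: insert_pos_bump.
have hx : x <= y by apply: nth_insert_pos.
have hl : insert_pos y d <= k.
  case: (ltnP k (size d)) => [kd|kd]; first by apply: insert_pos_leq; rewrite ?h2.
  by apply: leq_trans kd; apply: find_size.
have low i : i < size c -> nth 0 (ins_col x c) i <= nth 0 c i.
  by rewrite nth_ins_col; case: eqP => // -> _.
apply/col_leP; rewrite (size_ins_col_bump hb) {2}/ins_col size_set_nth; split; first by lia.
move=> i hi; rewrite [X in _ <= X]nth_ins_col; case: eqP => [->|/eqP ne].
  apply: (@leq_trans (nth 0 (ins_col x c) k)); last first.
    by rewrite nth_ins_col eqxx.
  by apply: col_leq_nth; rewrite ?sorted_ins_col ?size_ins_col_bump.
have hid : i < size d by move: hi; have := find_size (fun z => y <= z) d; rewrite -/(insert_pos y d); lia.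
by apply: leq_trans (h2 i hid); apply: low; lia.
Qed.

Lemma col_insert_neq0 x T : col_insert x T != [::].
Proof. by case: T => //= c T; case: ifP. Qed.

Lemma ins_col_neq0 x c : ins_col x c != [::].
Proof. by rewrite /ins_col -size_eq0 size_set_nth; lia. Qed.

Lemma col_tableau_insert x T : col_tableau T -> col_tableau (col_insert x T).
Proof.
elim: T x => // c T IHT x hT; have := hT; rewrite col_tableau_cons.
case/and4P=> sc c0 tT cT; rewrite col_insert_cons col_tableau_cons.
rewrite sorted_ins_col // ins_col_neq0 /=; case: ifPn => [h|h].
  rewrite tT ins_col_rcons //; apply: sub_all cT => d; exact: col_le_rcons.
rewrite IHT //; set y := nth 0 c _.
suff: path col_le (ins_col x c) (col_insert y T).
  by rewrite (path_sortedE col_le_trans) => /andP[].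
have := IHT y tT => /andP[_].
case: T cT {IHT hT tT} => [_ _|d T /andP[cd _]] /=.
  rewrite andbT.
  (* Opening a new column is an insertion into the empty column. *)
  have := @col_le_bump x c [::] sc h isT; exact.
rewrite -/(col_insert y (d :: T)) col_insert_cons /= => ->.
by rewrite andbT col_le_bump.
Qed.

Lemma col_tableau_bumping s : col_tableau (col_bumping s).
Proof.
elim/last_ind: s => // s x IHs; rewrite col_bumping_rcons.
exact: col_tableau_insert.
Qed.

(** * The row reading and the column reading of a tableau *)

Definition row_rev (T : seq (seq nat)) (i : nat) : seq nat :=
  rev [seq nth 0 c i | c <- T & i < size c].

Definition row_word (T : seq (seq nat)) : seq nat :=
  flatten [seq row_rev T i | i <- iota 0 (size (head [::] T))].

Lemma row_rev_cons c T i : row_rev (c :: T) i =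
  if i < size c then rcons (row_rev T i) (nth 0 c i) else row_rev T i.
Proof. by rewrite /row_rev /=; case: ifP => //= _; rewrite rev_cons. Qed.

Lemma row_rev_sorted T i : col_tableau T -> sorted geq (row_rev T i).
Proof.
case/andP=> _ sT; rewrite /row_rev rev_sorted.
apply: (homo_sorted_in (P := [pred c | i < size c]) (e := col_le)).
- by move=> c d hc hd /col_leP[_]; apply.
- exact: filter_all.
- exact: sorted_filter col_le_trans _ _ sT.
Qed.

Lemma row_rev_geq c T i : i < size c -> all (col_le c) T ->
  all (fun y => nth 0 c i <= y) (row_rev T i).
Proof.
move=> hi /allP cT; apply/allP => y; rewrite mem_rev => /mapP[d].
by rewrite mem_filter => /andP[hd /cT/col_leP[_ h]] ->; apply: h.
Qed.

(** Each letter [y] of [r] crosses [c] by [LR_equiv_col]. The letter [z] following [y] in [r ++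
    [:: x]] is the required witness: it is at most [y] and exceeds all of [c]. *)
Lemma LR_equiv_col_row c r x : sorted ltn c -> all (fun z => z < x) c ->
  sorted geq r -> all (fun y => x <= y) r ->
  LR_equiv (c ++ r ++ [:: x]) (r ++ c ++ [:: x]).
Proof.
move=> sc cx; elim: r => [|y r IHr] //= sr /andP[xy xr].
have {}IHr := IHr (path_sorted sr) xr.
apply: LR_equiv_trans (@LR_equiv_catl [:: y] _ _ IHr).
have [z [s [-> /andP[xz zy]]]] : exists z s, r ++ [:: x] = z :: s /\ x <= z <= y.
  case: r sr xr {IHr} => [|z r] /=; first by exists x, [::]; rewrite leqnn xy.
  move=> /andP[yz _] /andP[xz _]; exists z, (r ++ [:: x]).
  by rewrite xz.
have := @LR_equiv_col c z y sc _ zy.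
move/(_ (sub_all (fun t tx => leq_trans tx xz) cx))/(LR_equiv_catr s).
by rewrite -catA /= -catA.
Qed.

Lemma LR_equiv_row_word T : col_tableau T ->
  LR_equiv (row_word T) (column_word T).
Proof.
elim: T => [|c T IHT] // hT; have := hT; rewrite col_tableau_cons.
case/and4P=> sc _ tT cT; rewrite column_word_cons.
apply: LR_equiv_trans (LR_equiv_catr c (IHT tT)).
(* The first column is extracted row by row: its top [m] entries wait on the right and are carried
   past the next row of [T], which in [c :: T] ends with entry [m] of [c]. *)
have hm m : m <= size c -> LR_equiv
   (flatten [seq row_rev (c :: T) i | i <- iota 0 m])
   (flatten [seq row_rev T i | i <- iota 0 m] ++ take m c).
  elim: m => [|m IHm] hm; first by rewrite take0.
  rewrite -[m.+1]addn1 iotaD !map_cat !flatten_cat /= !cats0 add0n addn1.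
  apply: LR_equiv_trans (LR_equiv_catr _ (IHm (ltnW hm))) _.
  rewrite row_rev_cons hm (take_nth 0) // -!cats1 -!catA.
  apply: LR_equiv_catl; apply: LR_equiv_col_row.
  - exact: take_sorted.
  - apply/(all_nthP 0) => i; rewrite size_take hm => im.
    by rewrite nth_take // col_ltn_nth.
  - exact: row_rev_sorted.
  - exact: row_rev_geq.
have := hm _ (leqnn _); rewrite take_size /row_word /=.
suff -> : flatten [seq row_rev T i | i <- iota 0 (size c)] =
  flatten [seq row_rev T i | i <- iota 0 (size (head [::] T))] by [].
have hs d : d \in T -> size d <= size (head [::] T).
  case: T cT tT {hT hm IHT} => // d0 T _; rewrite col_tableau_cons inE.
  by case/and4P=> _ _ _ /allP h /predU1P[->|/h/col_leP[]] .
have hc : size (head [::] T) <= size c.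
  by case: T cT {hT hm IHT tT hs} => //= d T /andP[/col_leP[]].
(* The rows of [c :: T] below the first column of [T] contribute empty rows of [T]. *)
rewrite -(subnKC hc) iotaD map_cat flatten_cat.
rewrite [X in _ ++ X](_ : _ = [::]) ?cats0 //.
apply/nilP; rewrite /nilp size_flatten sumnE big1_seq // => k /andP[_] /mapP[r].
case/mapP=> i; rewrite mem_iota => /andP[hi _] -> ->.
rewrite size_rev size_map size_filter; apply/eqP; rewrite -leqn0 leqNgt -has_count.
by apply/hasPn => d /hs; rewrite -leqNgt => /leq_trans; apply.
Qed.

(** * The Robinson-Schensted-Knuth correspondence *)

(** The column determines the new box, whose row is the old length of that column; see
    [new_boxE]. *)
Definition new_col (x : nat) (T : seq (seq nat)) : nat := (new_box x T).2.

Lemma new_col_cons x c T : new_col x (c :: T) =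
  if all (fun y => y < x) c then 0
  else (new_col (nth 0 c (insert_pos x c)) T).+1.
Proof.
rewrite /new_col /=; case: ifP => // _.
by rewrite -/(insert_pos x c); case: (new_box _ T).
Qed.

Lemma new_boxE x T : new_box x T = (size (nth [::] T (new_col x T)), new_col x T).
Proof.
elim: T x => [|c T IHT] x //; rewrite new_col_cons /=; case: ifP => // _.
by rewrite -/(insert_pos x c) IHT.
Qed.

Lemma shape_col_insert x T :
  map size (col_insert x T) = incr_nth (map size T) (new_col x T).
Proof.
elim: T x => [|c T IHT] x //; rewrite new_col_cons col_insert_cons /=.
case: ifPn => h /=; first by rewrite ins_col_rcons // size_rcons.
by rewrite size_ins_col_bump // IHT.
Qed.

Definition add_rec (b j : nat) (Q : seq (seq nat)) : seq (seq nat) :=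
  set_nth [::] Q j (rcons (nth [::] Q j) b).

Lemma shape_add_rec b j Q : map size (add_rec b j Q) = incr_nth (map size Q) j.
Proof.
rewrite /add_rec; elim: Q j => [|q Q IHQ] [|j] //=.
- by elim: j => //= j ->.
- by rewrite size_rcons.
- by rewrite IHQ.
Qed.

Lemma perm_add_rec b j Q : perm_eq (flatten (add_rec b j Q)) (b :: flatten Q).
Proof.
rewrite /add_rec; elim: Q j => [|q Q IHQ] [|j] //=.
- by elim: j => //= j; rewrite nth_nil.
- by rewrite -cats1 -catA perm_catCA.
- by rewrite (perm_trans (perm_cat (perm_refl _) (IHQ j))) // -cat1s perm_catCA.
Qed.

Lemma nth_add_rec b j Q i : nth [::] (add_rec b j Q) i =
  if i == j then rcons (nth [::] Q j) b else nth [::] Q i.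
Proof. by rewrite /add_rec nth_set_nth. Qed.

Definition rsk_step (PQ : seq (seq nat) * seq (seq nat)) (p : nat * nat) :=
  (col_insert p.2 PQ.1, add_rec p.1 (new_col p.2 PQ.1) PQ.2).

Definition rsk (w : seq (nat * nat)) := foldl rsk_step ([::], [::]) w.

Lemma rsk_rcons w p : rsk (rcons w p) = rsk_step (rsk w) p.
Proof. by rewrite /rsk -cats1 foldl_cat. Qed.

Lemma rsk_col_bumping w : (rsk w).1 = col_bumping (unzip2 w).
Proof.
elim/last_ind: w => // w p IHw.
by rewrite rsk_rcons /= IHw /unzip2 map_rcons col_bumping_rcons.
Qed.

Lemma rsk_shape w : map size (rsk w).1 = map size (rsk w).2.
Proof.
elim/last_ind: w => // w p IHw.
by rewrite rsk_rcons shape_col_insert shape_add_rec IHw.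
Qed.

Lemma rsk_tableau w : col_tableau (rsk w).1.
Proof. by rewrite rsk_col_bumping col_tableau_bumping. Qed.

Lemma perm_rsk_rec w : perm_eq (flatten (rsk w).2) (unzip1 w).
Proof.
elim/last_ind: w => // w p IHw; rewrite rsk_rcons /unzip1 map_rcons.
rewrite (perm_trans (perm_add_rec _ _ _)) // perm_sym perm_rcons perm_cons.
by rewrite perm_sym.
Qed.

(** In each column the second letter lands strictly below the first, so the two bumped entries are
    again in strictly increasing order. *)
Lemma new_col_lt a a' T : col_tableau T -> a' < a ->
  new_col a (col_insert a' T) <= new_col a' T.
Proof.
elim: T a a' => [|c T IHT] a a' hT aa; first by rewrite /new_col /= aa.
move: hT; rewrite col_tableau_cons => /and4P[sc _ tT _].
rewrite col_insert_cons !new_col_cons.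
case: (boolP (all (fun y => y < a') c)) => h'.
  rewrite ins_col_rcons // all_rcons aa /=.
  by rewrite (sub_all _ h') // => y /= /ltn_trans; apply.
case: ifPn => // /insert_pos_bump h.
rewrite ltnS; apply: IHT => //; rewrite size_ins_col_bump // in h.
have hk : insert_pos a' c < insert_pos a (ins_col a' c).
  rewrite ltnNge; apply/negP => hle.
  have := @col_leq_nth _ _ (insert_pos a' c) (sorted_ins_col a' sc) _ hle.
  rewrite size_ins_col_bump // insert_pos_bump // => /(_ isT).
  rewrite (nth_ins_col _ _ (insert_pos a' c)) eqxx.
  have := @nth_insert_pos a (ins_col a' c); rewrite size_ins_col_bump // h.
  by move/(_ isT); lia.
by rewrite nth_ins_col gtn_eqF // col_ltn_nth.
Qed.

(** In each column the second letter lands at or above the place of [a'], so it bumps an entry at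
    most [a'], hence at most the entry bumped by [a']. In the column where the first insertion
    stops, the second one still bumps. *)
Lemma new_col_geq a a' T : col_tableau T -> a <= a' ->
  new_col a' T < new_col a (col_insert a' T).
Proof.
elim: T a a' => [|c T IHT] a a' hT aa.
  by rewrite /new_col /= [a' < a]ltnNge aa.
move: hT; rewrite col_tableau_cons => /and4P[sc _ tT _].
have sc' := sorted_ins_col a' sc.
have hk' : insert_pos a' c < size (ins_col a' c).
  by rewrite /ins_col size_set_nth leq_max leqnn.
have hk : insert_pos a (ins_col a' c) <= insert_pos a' c.
  by apply: insert_pos_leq => //; rewrite nth_ins_col eqxx.
rewrite col_insert_cons !new_col_cons; case: (boolP (all _ (ins_col _ _))).
  by rewrite all_ltn_insert_pos; lia.
case: (boolP (all (fun y => y < a') c)) => // h' _; rewrite ltnS; apply: IHT => //.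
apply: (@leq_trans a').
  have := col_leq_nth sc' hk' hk.
  by rewrite [X in _ <= X]nth_ins_col eqxx.
by apply: nth_insert_pos; apply: insert_pos_bump.
Qed.

Lemma eq_nth_notin0 (s t : seq nat) : 0 \notin s -> 0 \notin t ->
  (forall i, nth 0 s i = nth 0 t i) -> s = t.
Proof.
move=> s0 t0 e.
have le (u v : seq nat) : 0 \notin u -> (forall i, nth 0 u i = nth 0 v i) ->
    size u <= size v.
  move=> u0 euv; rewrite leqNgt; apply/negP => h; case/negP: u0.
  by rewrite -[0](nth_default 0 (leqnn (size v))) -euv mem_nth.
apply: (@eq_from_nth _ 0) => [|i _]; last exact: e.
by apply/eqP; rewrite eqn_leq !le.
Qed.

Lemma shape_notin0 T : col_tableau T -> 0 \notin map size T.
Proof.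
case/andP=> /allP h _; apply/mapP => -[c /h /andP[_ c0]] e.
by case/negP: c0; rewrite -size_eq0 -e.
Qed.

Lemma shape_nth T i : nth 0 (map size T) i = size (nth ([::] : seq nat) T i).
Proof.
case: (ltnP i (size T)) => h; first by rewrite (nth_map [::]).
by rewrite !nth_default ?size_map.
Qed.

(** The bumped entry [y] determines its row: it is the lowest row of the new column whose entry is
    at most [y]. *)
Lemma ins_col_inj a a' c c' (y := nth 0 c (insert_pos a c)) :
  sorted ltn c -> sorted ltn c' ->
  ~~ all (fun z => z < a) c -> ~~ all (fun z => z < a') c' ->
  ins_col a c = ins_col a' c' -> y = nth 0 c' (insert_pos a' c') ->
  a = a' /\ c = c'.
Proof.
move=> sc sc' hb hb' e ey.
have wlog_le b b' d d' : sorted ltn d -> ~~ all (fun z => z < b) d ->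
  ~~ all (fun z => z < b') d' ->
  ins_col b d = ins_col b' d' ->
  nth 0 d (insert_pos b d) = nth 0 d' (insert_pos b' d') ->
  insert_pos b' d' <= insert_pos b d.
  move=> sd hd hd' ed en.
  have lt' := insert_pos_bump hd'.
  rewrite leqNgt; apply/negP => lt.
  have /(congr1 (nth 0 ^~ (insert_pos b' d'))) := ed.
  rewrite !nth_ins_col eqxx gtn_eqF //.
  have sz : size d = size d' by rewrite -(size_ins_col_bump hd) ed size_ins_col_bump.
  have := col_ltn_nth sd _ lt; rewrite sz en => /(_ lt').
  have := nth_insert_pos lt'; lia.
have ek : insert_pos a' c' = insert_pos a c.
  by apply/eqP; rewrite eqn_leq !wlog_le.
have ea : a = a'.
  have /(congr1 (nth 0 ^~ (insert_pos a c))) := e.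
  by rewrite !nth_ins_col ek eqxx.
split=> //; apply: (@eq_from_nth _ 0) => [|i _].
  by rewrite -(size_ins_col_bump hb) e size_ins_col_bump.
have /(congr1 (nth 0 ^~ i)) := e; rewrite !nth_ins_col ek.
by case: eqP => // -> _; rewrite -/y ey ek.
Qed.

Lemma col_insert_inj a a' T T' : col_tableau T -> col_tableau T' ->
  col_insert a T = col_insert a' T' -> new_col a T = new_col a' T' ->
  a = a' /\ T = T'.
Proof.
elim: T T' a a' => [|c T IHT] [|c' T'] a a'.
- by move=> _ _ [].
- rewrite col_tableau_cons new_col_cons col_insert_cons => _ /and4P[_ c0 _ _].
  case: ifP => // h [] e _ _.
  by move: e; rewrite ins_col_rcons //; case: c' c0 {h} => [|? []].
- rewrite col_tableau_cons new_col_cons col_insert_cons => /and4P[_ c0 _ _] _.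
  case: ifP => // h [] e _ _.
  by move: e; rewrite ins_col_rcons //; case: c c0 {h} => [|? []].
rewrite !col_tableau_cons => /and4P[sc _ tT _] /and4P[sc' _ tT' _].
rewrite !new_col_cons !col_insert_cons.
case: (boolP (all _ c)) => h; case: (boolP (all _ c')) => h' //.
  by rewrite !ins_col_rcons // => -[/rcons_inj[-> ->] ->].
case=> e eT [] /(IHT _ _ _ tT tT' eT) [ey ->].
by have [-> ->] := ins_col_inj sc sc' h h' e ey.
Qed.

(** Reverse bumping: the entry at the bottom of column [j] is pushed back to the left, replacing in
    each column the lowest entry that does not exceed it. *)
Lemma col_insert_surj j T : col_tableau T -> j < size T ->
  size (nth [::] T j.+1) < size (nth [::] T j) ->
  exists a T', [/\ col_tableau T', col_insert a T' = T & new_col a T' = j].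
Proof.
elim: j T => [|j IHj] [|c T] //.
  rewrite col_tableau_cons /= nth0 => /and4P[sc c0 tT cT] _ hT.
  case: (lastP c) sc c0 cT hT => // {}c a sc _ cT; rewrite size_rcons ltnS => hT.
  have /andP[ca sc'] : all (fun y => y < a) c && sorted ltn c.
    by rewrite -sorted_ltn_rcons.
  case: (eqVneq c [::]) => [e|c0].
    exists a, [::]; rewrite e /=; split=> //; congr cons.
    case: T tT hT {cT} => // d T; rewrite col_tableau_cons e.
    by case/and4P=> _; case: d.
  exists a, (c :: T); rewrite col_insert_cons new_col_cons ca ins_col_rcons //.
  split=> //; rewrite col_tableau_cons c0 tT /=.
  have : path col_le c T.
    case: T tT cT hT => //= d T; rewrite /col_tableau /=.
    case/andP=> _ -> /andP[/col_leP[_ h] _] hd; rewrite andbT; apply/col_leP.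
    by split=> // i hi; have := h i hi; rewrite nth_rcons (leq_trans hi hd).
  by rewrite (path_sortedE col_le_trans) sc' => /andP[].
rewrite col_tableau_cons /= ltnS => /and4P[sc c0 tT cT] hj hs.
have [y [T' [tT' eT ej]]] := IHj T tT hj hs.
case: T tT cT hj hs eT {IHj} => [|e T]; first by rewrite ltn0.
move=> tT cT hj hs eT.
(* Here [d] is the first column of [T'], taken to be empty if [T'] has no columns. *)
have [d [eqe hl hsz]] : exists d, [/\ e = ins_col y d,
    T' = [::] /\ d = [::] \/ exists U, T' = d :: U & size d <= size e].
  case: T' eT {tT' ej} => [[<- _]|d U].
    by exists [::]; split=> //; left.
  rewrite col_insert_cons => -[<- _]; exists d; split=> //; first by right; exists U.
  exact: size_ins_col.
have /andP[/col_leP[ec hc] cT'] := cT.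
pose k' := insert_pos y d.
have k'e : k' < size e by rewrite eqe /ins_col size_set_nth leq_max leqnn.
have ek' : nth 0 e k' = y by rewrite eqe nth_ins_col eqxx.
(* The row [k'] of [y] in [e] shows existence, since [c] is entrywise at most [e]; hence the maximal
   [k] is at least [k'], which later gives [y <= nth 0 d k]. *)
have [k [kc ky ks]] : exists k, [/\ k < size c, nth 0 c k <= y &
    forall i, i < size c -> nth 0 c i <= y -> i <= k].
  have ex : exists k, (k < size c) && (nth 0 c k <= y).
    by exists k'; rewrite (leq_trans k'e ec) -ek' hc.
  have bd k : (k < size c) && (nth 0 c k <= y) -> k <= size c by case/andP=> /ltnW.
  case: (ex_maxnP ex bd) => k /andP[? ?] h; exists k; split=> // i h1 h2.
  by apply: h; rewrite h1.
have kk' : k' <= k by apply: ks; [apply: leq_trans ec|rewrite -ek' hc].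
pose c' := set_nth 0 c k y; pose a := nth 0 c k.
have szc' : size c' = size c by rewrite size_set_nth (maxn_idPr kc).
have nc' i : nth 0 c' i = if i == k then y else nth 0 c i by rewrite nth_set_nth.
have sc' : sorted ltn c'.
  apply/(sortedP 0) => i; rewrite szc' !nc' /= => hi.
  have /(sortedP 0)/(_ i hi) /= hs' := sc.
  case: (eqVneq i k) => [ik|ne].
    have -> : (i.+1 == k) = false by lia.
    rewrite ltnNge; apply/negP => /(ks i.+1 hi); lia.
  by case: (eqVneq i.+1 k) => // ik; rewrite -ik in ky; lia.
have posa : insert_pos a c' = k.
  apply/eqP; rewrite eqn_leq; apply/andP; split.
    by apply: insert_pos_leq; rewrite ?szc' // nc' eqxx.
  rewrite leqNgt; apply/negP => h.
  have h1 : insert_pos a c' < size c' by rewrite szc'; apply: ltn_trans h kc.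
  have := nth_insert_pos h1; rewrite nc' (ltn_eqF h) leqNgt.
  by rewrite col_ltn_nth.
have nall : all (fun z => z < a) c' = false.
  by rewrite all_ltn_insert_pos posa szc' ltn_eqF.
exists a, (c' :: T'); rewrite col_insert_cons new_col_cons nall posa nc' eqxx eT ej.
split=> //; last first.
  congr (_ :: _); rewrite /ins_col posa; apply: (@eq_from_nth _ 0).
    by rewrite size_set_nth szc' (maxn_idPr kc).
  by move=> i _; rewrite nth_set_nth /= nc'; case: eqP => // ->.
rewrite col_tableau_cons sc' tT' -size_eq0 szc' -lt0n (leq_ltn_trans _ kc) //=.
case: hl => [[-> //]|[U eU]]; move: tT'; rewrite eU => tT'.
have : path col_le c' (d :: U).
  have /andP[_ pU] := tT'; rewrite /= -/(sorted col_le (d :: U)) pU andbT.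
  apply/col_leP; rewrite szc'; split=> [|i hi]; first exact: leq_trans ec.
  rewrite nc'; case: (eqVneq i k) hi => [-> kd|_ hi].
    apply: leq_trans (@col_leq_nth d k' k _ kd kk').
      by apply: nth_insert_pos; apply: leq_ltn_trans kd.
    by have := col_tableau_sorted tT' => /andP[].
  apply: leq_trans (hc _ (leq_trans hi hsz)) _; rewrite eqe nth_ins_col.
  by case: (eqVneq i (insert_pos y d)) hi => // ->; apply: nth_insert_pos.
by rewrite (path_sortedE col_le_trans) => /andP[].
Qed.

Definition lex_le (p q : nat * nat) : bool :=
  (p.1 <= q.1) && ((p.1 == q.1) ==> (q.2 <= p.2)).

Lemma lex_le_trans : transitive lex_le.
Proof. by move=> [b a] [c d] [e f]; rewrite /lex_le /=; lia. Qed.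

Lemma lex_le_total : total lex_le.
Proof. by move=> [b a] [c d]; rewrite /lex_le /=; lia. Qed.

Lemma lexicographicE w : lexicographic w = sorted lex_le w.
Proof. by []. Qed.

Lemma lexicographic_pairwise w : lexicographic w = pairwise lex_le w.
Proof. by rewrite lexicographicE (sorted_pairwise lex_le_trans). Qed.

Lemma lexicographic_cat w1 w2 : lexicographic (w1 ++ w2) =
  [&& allrel lex_le w1 w2, lexicographic w1 & lexicographic w2].
Proof. by rewrite !lexicographic_pairwise pairwise_cat. Qed.

Lemma lexicographic_cons p w : lexicographic (p :: w) =
  all (lex_le p) w && lexicographic w.
Proof. by rewrite !lexicographic_pairwise. Qed.

Lemma lexicographic_rcons w p : lexicographic (rcons w p) =
  all (lex_le^~ p) w && lexicographic w.
Proof. by rewrite -cats1 lexicographic_cat allrel1r /= andbT. Qed.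

Lemma rsk_rec_leq w p : lexicographic (rcons w p) ->
  forall j, all (fun y => y <= p.1) (nth [::] (rsk w).2 j).
Proof.
rewrite lexicographic_rcons => /andP[/allP h _] j; apply/allP => y hy.
have : y \in unzip1 w.
  rewrite -(perm_mem (perm_rsk_rec w)); apply/flattenP; exists (nth [::] (rsk w).2 j) => //.
  case: (ltnP j (size (rsk w).2)) => hj; first exact: mem_nth.
  by move: hy; rewrite nth_default.
by case/mapP=> q /h /andP[? _] ->.
Qed.

(* Ties among the [b]'s come with weakly decreasing [a]'s, whose new boxes move
   strictly to the right. *)
Lemma rsk_rec_notin w b a : lexicographic (rcons w (b, a)) ->
  forall j, new_col a (rsk w).1 <= j -> b \notin nth [::] (rsk w).2 j.
Proof.
elim/last_ind: w b a => [|w [b0 a0] IHw] b a; first by move=> _ j _; rewrite nth_nil.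
rewrite lexicographic_rcons all_rcons -andbA => /and3P[h0 hw hl] j.
rewrite rsk_rcons /= => hj.
have hin i : b0 < b -> b \notin nth [::] (rsk w).2 i.
  move=> hb; apply/negP => /(allP (rsk_rec_leq hl i)) /=; lia.
rewrite nth_add_rec; case: (ltnP b0 b) => hb.
  case: eqP => _; rewrite ?mem_rcons ?inE ?negb_or hin // andbT; lia.
have [eb ha] : b0 = b /\ a <= a0 by move: h0; rewrite /lex_le /=; lia.
have := new_col_geq (rsk_tableau w) ha => lt.
rewrite gtn_eqF; last by lia.
by rewrite -eb; apply: IHw hl _ _; lia.
Qed.

(** The last pair can be read off: [b] is the largest recording entry, and by [rsk_rec_notin] its
    box is the rightmost occurrence of [b]. Reverse bumping from there is unique. *)
Lemma rsk_inj w u : lexicographic w -> lexicographic u -> rsk w = rsk u -> w = u.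
Proof.
have nonempty v p : rsk (rcons v p) <> ([::], [::]).
  by rewrite rsk_rcons => -[/eqP]; rewrite (negbTE (col_insert_neq0 _ _)).
elim/last_ind: w u => [|w [b a] IHw] u; case/lastP: u => [|u [d c]] //.
- by move=> _ _ /esym/nonempty.
- by move=> _ _ /nonempty.
move=> lw lu; rewrite !rsk_rcons => -[/= eP eQ].
have le v z p q : lexicographic (rcons v p) ->
    add_rec q.1 (new_col q.2 (rsk z).1) (rsk z).2 =
    add_rec p.1 (new_col p.2 (rsk v).1) (rsk v).2 -> q.1 <= p.1.
  move=> lv /(congr1 (nth [::] ^~ (new_col q.2 (rsk z).1))).
  rewrite !nth_add_rec eqxx => e.
  have : q.1 \in rcons (nth [::] (rsk z).2 (new_col q.2 (rsk z).1)) q.1.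
    by rewrite mem_rcons inE eqxx.
  rewrite e; case: eqP => _; last by move/(allP (rsk_rec_leq lv _)).
  by rewrite mem_rcons inE => /predU1P[->//|]; move/(allP (rsk_rec_leq lv _)).
have ebd : b = d.
  apply/eqP; rewrite eqn_leq.
  by rewrite (le u w (d, c) (b, a)) // (le w u (b, a) (d, c)).
subst d.
have lej v z a1 a2 : lexicographic (rcons v (b, a1)) ->
    add_rec b (new_col a1 (rsk v).1) (rsk v).2 =
    add_rec b (new_col a2 (rsk z).1) (rsk z).2 ->
    new_col a2 (rsk z).1 <= new_col a1 (rsk v).1.
  move=> lv e; rewrite leqNgt; apply/negP => lt.
  have := rsk_rec_notin lv (ltnW lt).
  have /(congr1 (nth [::] ^~ (new_col a2 (rsk z).1))) := e.
  by rewrite !nth_add_rec eqxx gtn_eqF // => ->; rewrite mem_rcons inE eqxx.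
have ej : new_col a (rsk w).1 = new_col c (rsk u).1.
  by apply/eqP; rewrite eqn_leq (lej w u) // (lej u w).
have [ea eP'] := col_insert_inj (rsk_tableau w) (rsk_tableau u) eP ej.
suff e : rsk w = rsk u.
  by rewrite ea (IHw u) //; move: lw lu; rewrite !lexicographic_rcons => /andP[_ ?] /andP[].
move: eP' (rsk_shape w) (rsk_shape u) eQ; rewrite ej.
case: (rsk w) (rsk u) => P Q [P' Q'] /= <- e1 e2 eQ; congr pair.
apply: (@eq_from_nth _ [::]) => [|i _]; first by rewrite -!(size_map size Q) -e1 e2 size_map.
have /(congr1 (nth [::] ^~ i)) := eQ; rewrite !nth_add_rec.
by case: eqP => // -> /rcons_inj[].
Qed.

(** The last conclusion lets the induction put back the columns on the left: they stay comparable
    with a shortened column. *)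
Lemma add_rec_surj j q b Q : col_tableau Q -> nth [::] Q j = rcons q b ->
  size (nth [::] Q j.+1) < size (rcons q b) ->
  exists Q', [/\ col_tableau Q', add_rec b j Q' = Q
    & forall c, all (col_le c) Q -> all (col_le c) Q'].
Proof.
elim: j Q => [|j IHj] [|c Q];
  try by move=> _ /(congr1 size); rewrite ?nth_nil size_rcons.
  rewrite /= col_tableau_cons size_rcons nth0 => /and4P[sc c0 tQ cQ] ec hQ.
  rewrite ec in sc c0 cQ.
  case: (eqVneq q [::]) => [e|q0].
    exists [::]; split=> //; rewrite /add_rec ec e /=; congr cons.
    case: Q tQ hQ {cQ} => // d Q; rewrite col_tableau_cons e.
    by case/and4P=> _; case: d.
  have sq : sorted ltn q by move: sc; rewrite sorted_ltn_rcons => /andP[].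
  exists (q :: Q); split.
  - rewrite col_tableau_cons sq q0 tQ /=.
    have : path col_le q Q.
      case: Q tQ cQ hQ => //= d Q; rewrite /col_tableau /=.
      case/andP=> _ -> /andP[/col_leP[_ h] _] hd; rewrite andbT; apply/col_leP.
      by split=> // i hi; have := h i hi; rewrite nth_rcons (leq_trans hi hd).
    by rewrite (path_sortedE col_le_trans) => /andP[].
  - by rewrite ec.
  move=> d /= /andP[/col_leP[]]; rewrite ec size_rcons => h1 h2 ->; rewrite andbT.
  apply/col_leP; split; first exact: ltnW.
  by move=> i hi; have := h2 i (leqW hi); rewrite nth_rcons hi.
rewrite col_tableau_cons => /and4P[sc c0 tQ cQ] eq hs.
have [Q' [tQ' eQ' hQ']] := IHj Q tQ eq hs.
exists (c :: Q'); split.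
- by rewrite col_tableau_cons sc c0 tQ' hQ'.
- by rewrite -eQ'.
by move=> d /= /andP[-> /hQ'].
Qed.

Lemma max_in (s : seq nat) : s != [::] ->
  exists2 b, b \in s & all (fun y => y <= b) s.
Proof.
elim: s => // x [|y s] IHs _; first by exists x; rewrite ?inE //= leqnn.
have [//|b hb hs] := IHs; case: (leqP x b) => xb.
  by exists b; [rewrite inE hb orbT|rewrite /= xb].
exists x; first by rewrite inE eqxx.
by rewrite /= leqnn; apply: sub_all hs => z /= hz; lia.
Qed.

(** Induction on the number of boxes: undo the insertion at the rightmost occurrence of the largest
    entry [b] of [Q]. Choosing the rightmost one makes its box a corner and keeps the array
    lexicographic. *)
Lemma rsk_surj P Q : col_tableau P -> col_tableau Q -> map size P = map size Q ->
  exists2 w, lexicographic w & rsk w = (P, Q).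
Proof.
have [n] := ubnP (size (flatten Q)); elim: n P Q => // n IHn P Q hn tP tQ hPQ.
case: (eqVneq Q [::]) => [e|Q0].
  by exists [::] => //; move: hPQ; rewrite e; case: P {tP}.
have fl0 : flatten Q != [::].
  case: Q tQ Q0 {hPQ hn} => // q Q; rewrite col_tableau_cons => /and4P[_ q0 _ _] _.
  by apply: contra q0; case: q.
have [b bQ maxb] := max_in fl0.
have maxn j : all (fun y => y <= b) (nth [::] Q j).
  case: (ltnP j (size Q)) => hj; last by rewrite nth_default.
  apply/allP => y hy; apply: (allP maxb); apply/flattenP.
  by exists (nth [::] Q j) => //; apply: mem_nth.
have ex : exists j, b \in nth [::] Q j.
  by have /flattenP[q /(nthP [::])[j _ <-] hb] := bQ; exists j.
have bd j : b \in nth [::] Q j -> j <= size Q.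
  by move=> h; rewrite leqNgt; apply/negP => hj; move: h; rewrite nth_default // ltnW.
case: (ex_maxnP ex bd) => j bj maxj {ex bd}.
have jQ : j < size Q.
  by rewrite ltnNge; apply/negP => hj; move: bj; rewrite nth_default.
have sQ i : i < size Q -> sorted ltn (nth [::] Q i).
  by move=> hi; apply: (allP (col_tableau_sorted tQ)); apply: mem_nth.
have [q eq] : exists q, nth [::] Q j = rcons q b.
  have := sQ j jQ; case/lastP: (nth _ _ _) bj (maxn j) => // q b'.
  rewrite mem_rcons inE => /predU1P[->|bq]; first by exists q.
  rewrite all_rcons sorted_ltn_rcons => /andP[hb _] /andP[/allP/(_ b bq) /=]; lia.
(* Otherwise the entry of column [j.+1] in the row of [b] would be at least [b], hence another [b]
   further right. *)
have corner : size (nth [::] Q j.+1) < size (rcons q b).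
  rewrite size_rcons ltnNge; apply/negP => h.
  have j1 : j.+1 < size Q.
    by rewrite ltnNge; apply/negP => hj; move: h; rewrite nth_default.
  have /andP[_ /(sortedP [::])/(_ j j1)/col_leP[_ /(_ (size q) h)]] := tQ.
  rewrite eq nth_rcons ltnn eqxx => hb.
  have hin := mem_nth 0 h.
  have e : b = nth 0 (nth [::] Q j.+1) (size q).
    by apply/eqP; rewrite eqn_leq hb (allP (maxn _) _ hin).
  by move: (maxj j.+1); rewrite e hin ltnn => /(_ isT).
have [Q' [tQ' eQ' _]] := add_rec_surj tQ eq corner.
have [a [P' [tP' eP' ej]]] : exists a P',
    [/\ col_tableau P', col_insert a P' = P & new_col a P' = j].
  apply: col_insert_surj => //; first by rewrite -(size_map size) hPQ size_map.
  by rewrite -!shape_nth hPQ !shape_nth eq.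
have hPQ' : map size P' = map size Q'.
  apply: eq_nth_notin0; rewrite ?shape_notin0 // => i.
  have := congr1 (nth 0 ^~ i) hPQ.
  by rewrite -eP' -eQ' shape_col_insert shape_add_rec ej !nth_incr_nth => /addnI.
have [|w lw ew] := IHn P' Q' _ tP' tQ' hPQ'.
  by move: hn; rewrite -eQ' (perm_size (perm_add_rec _ _ _)).
exists (rcons w (b, a)); last by rewrite rsk_rcons ew /rsk_step /= ej eP' eQ'.
case/lastP: w lw ew => [|w [b0 a0]] // lw ew.
suff h : lex_le (b0, a0) (b, a).
  rewrite lexicographic_rcons lw all_rcons h !andbT /=.
  move: lw; rewrite lexicographic_rcons => /andP[hw _].
  by apply: sub_all hw => p /lex_le_trans; apply.
have : b0 \in flatten Q.
  rewrite -eQ' (perm_mem (perm_add_rec _ _ _)) inE.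
  have -> : Q' = (rsk (rcons w (b0, a0))).2 by rewrite ew.
  by rewrite (perm_mem (perm_rsk_rec _)) /unzip1 map_rcons mem_rcons inE eqxx orbT.
move/(allP maxb) => hb; rewrite /lex_le /= hb /=; apply/implyP => /eqP e; subst b0.
(* If a tie had [a0 < a], [new_col_lt] would put the earlier [b] in column [j] or to its right:
   either twice in one strict column, or against the maximality of [j]. *)
rewrite leqNgt; apply/negP => lt; move: ew; rewrite rsk_rcons => -[/= eP2 eQ2].
have := new_col_lt (rsk_tableau w) lt; rewrite eP2 ej.
set j0 := new_col a0 (rsk w).1 in eQ2 *.
have q0 : nth [::] Q' j0 = rcons (nth [::] (rsk w).2 j0) b.
  by rewrite -eQ2 nth_add_rec eqxx.
rewrite leq_eqVlt => /predU1P[jj|jj].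
  have := sQ j jQ; rewrite -eQ' nth_add_rec eqxx jj q0.
  by rewrite sorted_ltn_rcons all_rcons ltnn.
have := maxj j0; rewrite -{1}eQ' nth_add_rec gtn_eqF // q0 mem_rcons inE eqxx.
by move/(_ isT); lia.
Qed.

(** * Symmetry of the correspondence *)

(* The state consists of the first column of the bumping tableau, the first
   column of the recording tableau, and the array of the bumped entries, which
   is inserted into the remaining columns. *)
Definition peel_step (st : seq nat * seq nat * seq (nat * nat)) (p : nat * nat) :=
  let: (c, r, o) := st in
  if all (fun y => y < p.2) c then (ins_col p.2 c, rcons r p.1, o)
  else (ins_col p.2 c, r, rcons o (p.1, nth 0 c (insert_pos p.2 c))).

Definition peel (w : seq (nat * nat)) := foldl peel_step ([::], [::], [::]) w.

Lemma peel_rcons w p : peel (rcons w p) = peel_step (peel w) p.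
Proof. by rewrite /peel -cats1 foldl_cat. Qed.

(** The array is nonempty because [rsk [::]] has no first column to split off. *)
Lemma rsk_peel p w : let: (c, r, o) := peel (p :: w) in
  rsk (p :: w) = (c :: (rsk o).1, r :: (rsk o).2).
Proof.
elim/last_ind: w => [|w q] //; rewrite -rcons_cons peel_rcons rsk_rcons.
case: (peel _) => -[c r] o -> /=; case: ifPn => h.
  by rewrite /rsk_step new_col_cons col_insert_cons h.
by rewrite rsk_rcons /rsk_step new_col_cons col_insert_cons (negbTE h).
Qed.

Lemma peel_subset w : let: (c, r, o) := peel w in
  {subset c <= unzip2 w} /\ {subset r <= unzip1 w}.
Proof.
elim/last_ind: w => // w [b a]; rewrite peel_rcons /unzip1 /unzip2 !map_rcons.
case: (peel w) => -[c r] o [hc hr] /=.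
have hi : {subset ins_col a c <= rcons (unzip2 w) a}.
  move=> y; rewrite mem_rcons inE => /(nthP 0)[i hi <-]; rewrite nth_ins_col.
  case: (eqVneq i (insert_pos a c)) => [_|ne]; first by rewrite eqxx.
  rewrite hc ?orbT // mem_nth //; move: hi; rewrite /ins_col size_set_nth.
  have := find_size (fun z => a <= z) c; rewrite -/(insert_pos a c).
  move=> hk; rewrite leq_max ltnS [i <= _]leq_eqVlt (negbTE ne) /=.
  by case/orP=> // /leq_trans->.
case: ifP => _; split=> // y; rewrite !mem_rcons !inE.
  by case/predU1P=> [->|/hr->]; rewrite ?eqxx ?orbT.
by move/hr->; rewrite orbT.
Qed.

Lemma insert_pos_rcons x y c : ~~ all (fun z => z < x) c ->
  insert_pos x (rcons c y) = insert_pos x c.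
Proof.
move=> h; rewrite /insert_pos -cats1 find_cat has_find.
by have := insert_pos_bump h; rewrite /insert_pos => ->.
Qed.

Lemma ins_col_rcons_bump x y c : ~~ all (fun z => z < x) c ->
  ins_col x (rcons c y) = rcons (ins_col x c) y.
Proof.
move=> h; have hk := insert_pos_bump h.
apply: (@eq_from_nth _ 0) => [|i _].
  by rewrite size_rcons !size_ins_col_bump ?all_rcons ?negb_and ?h ?orbT // size_rcons.
rewrite nth_ins_col insert_pos_rcons // !nth_rcons nth_ins_col size_ins_col_bump //.
by case: (eqVneq i (insert_pos x c)) => // ->; rewrite hk.
Qed.

Lemma nth_rcons_bump x y c : ~~ all (fun z => z < x) c ->
  nth 0 (rcons c y) (insert_pos x c) = nth 0 c (insert_pos x c).
Proof. by move=> h; rewrite nth_rcons insert_pos_bump. Qed.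

Lemma insert_pos_rcons_all x y c : all (fun z => z < x) c -> x <= y ->
  insert_pos x (rcons c y) = size c.
Proof.
move=> h xy; rewrite /insert_pos -cats1 find_cat.
case: ifP => [|_] /=; last by rewrite xy addn0.
by case/hasP=> z /(allP h); lia.
Qed.

Lemma ins_col_rcons_all x y c : all (fun z => z < x) c -> x <= y ->
  ins_col x (rcons c y) = rcons c x.
Proof.
move=> h xy; rewrite /ins_col insert_pos_rcons_all //.
by elim: c {h} => //= z c ->.
Qed.

Lemma all_ins_col x a c : all (fun z => z < a) c ->
  ~~ all (fun z => z < x) c -> all (fun z => z < a) (ins_col x c).
Proof.
move=> /allP ha h; have hk := insert_pos_bump h; apply/(all_nthP 0) => i.
rewrite size_ins_col_bump // nth_ins_col => hi; case: eqP => _; last first.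
  by apply/ha/mem_nth.
exact: leq_ltn_trans (nth_insert_pos hk) (ha _ (mem_nth 0 hk)).
Qed.

Definition swap_pair (p : nat * nat) : nat * nat := (p.2, p.1).

(* Once a later point [q] creates a new row of the first column, it bumps [a]
   if [p = (b, a)] is present; from then on both runs have the same column. *)
Lemma peel_insert w1 b a w2 :
  all (fun q => (q.1 < b) && (q.2 < a)) w1 ->
  all (fun q => (b <= q.1) && (q.2 <= a)) w2 ->
  let: (c, r, o) := peel (w1 ++ w2) in
  let: (c', r', o') := peel (w1 ++ (b, a) :: w2) in
  [/\ all (fun z => z < a) c, all (fun z => z < b) r, c' = rcons c a,
      r' = rcons r b & o' = o] \/
  [/\ ~~ all (fun z => z < b) r, r' = ins_col b r, c' = c
    & perm_eq o' ((nth 0 r (insert_pos b r), a) :: o)].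
Proof.
move=> h1; elim/last_ind: w2 => [_|w2 [d e] IHw].
  rewrite cats0 cats1 peel_rcons.
  have := peel_subset w1; case: (peel w1) => -[c r] o [hc hr] /=.
  have ac : all (fun z => z < a) c.
    by apply/allP => y /hc /mapP[q /(allP h1) /andP[_ ?] ->].
  have ar : all (fun z => z < b) r.
    by apply/allP => y /hr /mapP[q /(allP h1) /andP[? _] ->].
  by rewrite ac; left; rewrite ins_col_rcons.
rewrite all_rcons => /andP[/= /andP[bd ea] /IHw].
rewrite -rcons_cons -!rcons_cat !peel_rcons.
case: (peel _) => -[c r] o; case: (peel _) => -[c' r'] o' /=.
case=> [[ac ar -> -> ->]|[ar -> -> po]].
  rewrite all_rcons [a < e]ltnNge ea /=.
  case: (boolP (all _ c)) => h; last first.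
    left; split=> //; first exact: all_ins_col.
      by rewrite ins_col_rcons_bump.
    by rewrite insert_pos_rcons // nth_rcons_bump.
  right; split.
  - by rewrite all_rcons negb_and -leqNgt bd.
  - by rewrite ins_col_rcons_all.
  - by rewrite ins_col_rcons_all // ins_col_rcons.
  by rewrite !insert_pos_rcons_all // !nth_rcons !ltnn !eqxx perm_rcons.
case: (boolP (all _ c)) => h; right; split=> //.
- by rewrite all_rcons negb_and ar orbT.
- by rewrite ins_col_rcons_bump.
- by rewrite insert_pos_rcons // nth_rcons_bump.
- by rewrite -rcons_cons -!cats1 perm_cat2r.
Qed.

Lemma split_first (T : eqType) (x : T) s : x \in s ->
  exists s1 s2, s = s1 ++ x :: s2 /\ x \notin s1.
Proof.
elim: s => // y s IHs; rewrite inE; case: eqVneq => [-> _|ne /= /IHs].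
  by exists [::], s.
case=> s1 [s2 [-> h]]; exists (y :: s1), s2; split=> //.
by rewrite inE negb_or ne.
Qed.

(** Induction on [w']: appending its last point [(a, b)] has, up to the exchange, the effect that
    [peel_insert] gives for inserting [(b, a)] into [w]. *)
Lemma peel_swap w w' : lexicographic w -> lexicographic w' ->
  perm_eq w' (map swap_pair w) ->
  let: (c, r, o) := peel w in let: (c', r', o') := peel w' in
  [/\ c' = r, r' = c & perm_eq o' (map swap_pair o)].
Proof.
elim/last_ind: w' w => [|w' [a b] IHw] w lw lw' pw.
  by have := perm_size pw; case: w {lw pw}.
have /mapP[[b' a'] pinw [ea eb]] : (a, b) \in map swap_pair w.
  by rewrite -(perm_mem pw) mem_rcons inE eqxx.
(* Splitting at the first occurrence excludes copies of [(b, a)] from [w1]; the two lexicographic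
   orders then make its points strictly smaller in both coordinates. *)
move: ea eb pinw => /= <- <- {a' b'} /split_first[w1 [w2 [ew p1]]].
have le q : q \in w -> lex_le (swap_pair q) (a, b).
  move=> hq; have : swap_pair q \in rcons w' (a, b).
    by rewrite (perm_mem pw) map_f.
  rewrite mem_rcons inE => /predU1P[->|hq']; first by rewrite /lex_le /=; lia.
  by move: lw'; rewrite lexicographic_rcons => /andP[/allP/(_ _ hq')].
have pw' : perm_eq w' (map swap_pair (w1 ++ w2)).
  move: pw; rewrite ew -cats1 !map_cat /= => /perm_trans h.
  rewrite -(perm_cat2r [:: (a, b)]); apply: h.
  by rewrite -catA perm_cat2l -cat1s perm_catC.
have lw12 : lexicographic (w1 ++ w2).
  move: lw; rewrite ew !lexicographic_cat lexicographic_cons.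
  case/and3P=> /allrelP h -> /andP[_ ->]; rewrite !andbT.
  by apply/allrelP => q q' hq hq'; apply: h => //; rewrite inE hq' orbT.
move: lw; rewrite {1}ew lexicographic_cat lexicographic_cons.
case/and3P=> /allrelP h1 _ /andP[/allP h2 _].
have := @peel_insert w1 b a w2; rewrite -ew.
move/(_ _ _); have /IHw := pw'; rewrite peel_rcons.
move: lw'; rewrite lexicographic_rcons => /andP[_ lw'] /(_ lw12 lw').
case: (peel w) => -[c r] o; case: (peel w') => -[c' r'] o'.
case: (peel (w1 ++ w2)) => -[c0 r0] o0 [-> -> po] /=.
case.
- apply/allP => -[d e] hq; have := h1 _ (b, a) hq; rewrite inE eqxx => /(_ isT).
  have := le (d, e); rewrite ew mem_cat hq => /(_ isT).
  have : (d, e) != (b, a) by apply: contraNneq p1 => <-.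
  rewrite /lex_le /= xpair_eqE; lia.
- apply/allP => -[d e] hq; have := h2 _ hq.
  have := le (d, e); rewrite ew mem_cat inE hq !orbT => /(_ isT).
  rewrite /lex_le /=; lia.
- case=> ac ar -> -> ->; rewrite ar; split=> //.
  by rewrite ins_col_rcons.
case=> ar -> -> po2; rewrite (negbTE ar); split=> //.
rewrite perm_rcons perm_sym; apply: perm_trans (perm_map _ po2) _ => /=.
by rewrite perm_cons perm_sym.
Qed.

(** Keeping [p.2] in [c] controls ties: if [q.1 = p.1] then [q.2 <= p.2], so [q] bumps an entry at
    most [p.2], which is at most every letter already bumped with that label. *)
Lemma peel_lexicographic w p : lexicographic (rcons w p) ->
  let: (c, r, o) := peel (rcons w p) in
  [/\ sorted ltn c, p.2 \in c, lexicographic o & all (lex_le^~ p) o].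
Proof.
elim/last_ind: w p => [|w p IHw] q; first by rewrite /= inE eqxx.
rewrite lexicographic_rcons all_rcons -andbA => /and3P[pq _ /IHw].
rewrite (peel_rcons (rcons w p)); case: (peel _) => -[c r] o [sc pc lo po].
have mq : q.2 \in ins_col q.2 c.
  have hk : insert_pos q.2 c < size (ins_col q.2 c).
    by rewrite /ins_col size_set_nth leq_max leqnn.
  by have := mem_nth 0 hk; rewrite nth_ins_col eqxx.
have poq : all (lex_le^~ q) o.
  by apply: sub_all po => z /lex_le_trans; apply.
rewrite /peel_step; case: ifPn => h; first by rewrite sorted_ins_col.
have hk := insert_pos_bump h; have hq := nth_insert_pos hk.
split=> //; first exact: sorted_ins_col.
  rewrite lexicographic_rcons lo andbT; apply/allP => z /(allP po).
  move: pq; rewrite /lex_le /= => hpq hz.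
  case: (leqP q.2 p.2) => qp; last by lia.
  suff : nth 0 c (insert_pos q.2 c) <= p.2 by lia.
  have ip : index p.2 c < size c by rewrite index_mem.
  rewrite -[X in _ <= X](nth_index 0 pc); apply: col_leq_nth => //.
  by apply: insert_pos_leq => //; rewrite nth_index.
by rewrite all_rcons poq andbT /lex_le /= leqnn eqxx.
Qed.

Lemma size_peel w : let: (c, r, o) := peel w in size c + size o = size w.
Proof.
elim/last_ind: w => // w p; rewrite peel_rcons size_rcons.
case: (peel w) => -[c r] o <- /=; case: ifPn => h.
  by rewrite ins_col_rcons // size_rcons.
by rewrite size_ins_col_bump // size_rcons addnS.
Qed.

Lemma rsk_swap w w' : lexicographic w -> lexicographic w' ->
  perm_eq w' (map swap_pair w) -> rsk w' = ((rsk w).2, (rsk w).1).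
Proof.
have [n] := ubnP (size w); elim: n w w' => // n IHn w w' hn lw lw' pw.
have sz := perm_size pw; rewrite size_map in sz.
case: w w' => [|p w] [|p' w'] // in hn lw lw' pw sz *.
have := rsk_peel p w; have := rsk_peel p' w'; have := size_peel (p :: w).
have := peel_swap lw lw' pw.
have := @peel_lexicographic (belast p w) (last p w); rewrite -lastI => /(_ lw).
have := @peel_lexicographic (belast p' w') (last p' w'); rewrite -lastI => /(_ lw').
case: (peel _) => -[c' r'] o' [_ _ lo' _].
case: (peel _) => -[c r] o [_ hc lo _] [-> -> po] hs -> -> /=.
rewrite (IHn o o') //=.
by case: c hc hs => //= x c _ hs; move: hn; rewrite /= -hs; lia.
Qed.

(** * Young diagrams and boxes *)

Lemma notin0P (s : seq nat) :
  reflect (forall i, i < size s -> 0 < nth 0 s i) (0 \notin s).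
Proof.
apply: (iffP idP) => [s0 i hi|h].
  by rewrite lt0n; apply: contraNneq s0 => <-; apply: mem_nth.
by apply/(nthP 0) => -[i /h] /[swap] ->.
Qed.

Lemma is_youngP la : reflect (dominant (nth 0 la) /\ 0 \notin la) (is_young la).
Proof.
apply: (iffP andP) => -[h h0]; split=> //.
  move=> i; case: (ltnP i.+1 (size la)) => hi; last by rewrite nth_default.
  by have /(sortedP 0)/(_ i hi) := h.
by apply/(sortedP 0) => i _; apply: h.
Qed.

Lemma nth_incr (la : seq nat) i : nth 0 (incr_nth la i) =1 add_at (nth 0 la) i.
Proof. by move=> j; rewrite nth_incr_nth /add_at addnC eq_sym. Qed.

Lemma is_young_incr la i : is_young la ->
  is_young (incr_nth la i) = (i == 0) || (nth 0 la i < nth 0 la i.-1).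
Proof.
move=> /is_youngP[dla la0]; apply/is_youngP/idP => [[h _]|h].
  case: i h => [|i] // /(_ i); rewrite !nth_incr /add_at eqxx /=.
  by rewrite ltn_eqF // addn0 addn1.
split; first by move=> j; rewrite !nth_incr; apply: dominant_add.
apply/notin0P => j; rewrite nth_incr /add_at; case: eqP => [_|ne].
  by rewrite addn1.
rewrite addn0 size_incr_nth; case: ifP => [_|hi]; first by move/notin0P: la0; apply.
(* No padding zero can appear: row [i.-1] being nonempty forces [i <= size la]. *)
have ei : i = size la; last by rewrite ltnS => hj; apply: (notin0P _ la0); lia.
case: i h hi {ne} => [|i] /= h hi; first by lia.
have : i < size la by rewrite ltnNge; apply/negP => hi'; move: h; rewrite (nth_default 0 hi').
lia.
Qed.

Lemma nth_add_boxes la s j :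
  nth 0 (add_boxes la s) j = nth 0 la j + count_mem j s.
Proof.
elim: s la => [|i s IHs] la /=; first by rewrite addn0.
by rewrite IHs nth_incr /add_at -addnA eq_sym.
Qed.

Lemma young_prefixes la s : is_young la ->
  (forall k, 0 < k <= size s -> is_young (add_boxes la (take k s))) <->
  dominant_word (nth 0 la) s.
Proof.
elim: s la => [|i s IHs] la yla /=; first by split=> // _ [].
have e := eq_dominant_word s (nth_incr la i).
split=> [h|/andP[hi hs] [|k] //= hk].
  have yi : is_young (incr_nth la i) by have := h 1 isT; rewrite /= take0.
  rewrite -is_young_incr // yi -e; apply/IHs => // k /andP[k0 hk].
  by apply: (h k.+1).
have yi : is_young (incr_nth la i) by rewrite is_young_incr.
case: k hk => [|k] hk; first by rewrite take0.
by move: hs; rewrite -e => /(IHs _ yi); apply.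
Qed.

Lemma is_young_add_boxes la s : is_young la -> dominant_word (nth 0 la) s ->
  is_young (add_boxes la s).
Proof.
move=> yla /(young_prefixes _ yla) /(_ (size s)).
by rewrite take_size leqnn andbT; case: s => // i s; apply.
Qed.

Lemma LR_wordP la nu s : is_young la -> is_young nu -> incl_young la nu ->
  LR_word la nu s <->
  dominant_word (nth 0 la) s /\ forall i, count_mem i s = skew_row la nu i.
Proof.
move=> yla ynu lanu; split=> [[/young_prefixes h <-]|[hs hc]].
  split; first exact: h.
  by move=> i; rewrite /skew_row nth_add_boxes addKn.
split; first exact/young_prefixes.
have /is_youngP[_ nu0] := ynu; have /is_youngP[_ s0] := is_young_add_boxes yla hs.
apply: eq_nth_notin0 => // i.
by rewrite nth_add_boxes hc /skew_row subnKC.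
Qed.

Lemma LR_word_equiv la nu s t : is_young la -> LR_equiv s t ->
  LR_word la nu s -> LR_word la nu t.
Proof.
move=> yla [pst est] [/(young_prefixes _ yla) hs <-].
have /is_youngP[dla _] := yla.
have ht : dominant_word (nth 0 la) t by rewrite -est.
split; first exact/young_prefixes.
apply: eq_nth_notin0.
- by have /is_youngP[] := is_young_add_boxes yla ht.
- by have /is_youngP[] := is_young_add_boxes yla hs.
by move=> i; rewrite !nth_add_boxes (permP pst).
Qed.

(** Every letter is the index of a nonempty row of [nu]; this supplies the bound on entries in
    [is_tableau]. *)
Lemma LR_word_leq la nu s n : size nu <= n -> LR_word la nu s ->
  all (fun i => i <= n) s.
Proof.
move=> hn [_ e]; apply/allP => i hi; apply: ltnW; apply: leq_trans hn.
rewrite ltnNge; apply/negP => /(nth_default 0).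
  rewrite -e nth_add_boxes => /eqP; rewrite addn_eq0 => /andP[_].
  by rewrite -leqn0 leqNgt -has_count has_pred1 hi.
Qed.

(** Letters decrease weakly under a common label [x], so row [i.+1] is longest relative to row [i]
    after all its letters with label at most [x] and before the letters [i] with label [x]. *)
Lemma dominant_word_lexicographic f w : dominant f -> lexicographic w ->
  dominant_word f (unzip2 w) <->
  forall i x, f i.+1 + count (fun p => (p.1 <= x) && (p.2 == i.+1)) w <=
              f i + count (fun p => (p.1 < x) && (p.2 == i)) w.
Proof.
elim: w f => [|[y j] w IHw] f df.
  by move=> _; split=> // _ i x; rewrite !addn0; apply: df.
rewrite lexicographic_cons => /andP[/allP hyj lw].
have zero (P : nat -> nat -> bool) :
    (forall p, lex_le (y, j) p -> P p.1 p.2 -> False) ->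
    count (fun p => P p.1 p.2) w = 0.
  move=> h; apply/eqP; rewrite -leqn0 leqNgt -has_count; apply/hasPn => p hp.
  by apply/negP => /(h p (hyj p hp)).
have zle x i : x < y ->
    count (fun p => (p.1 <= x) && (p.2 == i.+1)) w = 0.
  move=> xy; apply: (zero (fun a b => (a <= x) && (b == i.+1))) => p.
  rewrite /lex_le /=; lia.
have zlt x i : x <= y -> count (fun p => (p.1 < x) && (p.2 == i)) w = 0.
  move=> xy; apply: (zero (fun a b => (a < x) && (b == i))) => p.
  rewrite /lex_le /=; lia.
have zj x i : x <= y -> j <= i ->
    count (fun p => (p.1 <= x) && (p.2 == i.+1)) w = 0.
  move=> xy ji; apply: (zero (fun a b => (a <= x) && (b == i.+1))) => p.
  rewrite /lex_le /=; lia.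
(* Moving the first letter into [f] changes the inequality only if its label is too large to be
   counted; then the remaining counts vanish and both forms hold. *)
have step i x : (j == 0) || (f j < f j.-1) ->
    (f i.+1 + ((y <= x) && (j == i.+1) +
       count (fun p => (p.1 <= x) && (p.2 == i.+1)) w) <=
     f i + ((y < x) && (j == i) + count (fun p => (p.1 < x) && (p.2 == i)) w)) =
    (add_at f j i.+1 + count (fun p => (p.1 <= x) && (p.2 == i.+1)) w <=
     add_at f j i + count (fun p => (p.1 < x) && (p.2 == i)) w).
  rewrite /add_at ![_ == j]eq_sym => hj; have := df i.
  case: (eqVneq j i.+1) hj => [-> /= hj di|ne _].
    rewrite gtn_eqF // andbF andbT.
    by case: (leqP y x) => xy; [lia|rewrite zle // zlt; lia].
  case: (eqVneq j i) => [e di|ne' _]; last by rewrite !andbF; lia.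
  rewrite andbF andbT; case: (ltnP y x) => xy; first by lia.
  by rewrite zj // ?zlt //; lia.
split=> /= [/andP[hj hw] i x|h].
  by rewrite step //; apply: (IHw _ (dominant_add df hj) lw).1.
have hj : (j == 0) || (f j < f j.-1).
  case: j {hyj zero zj step} h => [|j] //= /(_ j y).
  by rewrite leqnn eqxx ltnn (zlt y) //=; lia.
rewrite hj /=; apply/IHw => //; first exact: dominant_add.
by move=> i x; rewrite -step.
Qed.

(** * The reading order on boxes, and fillings as functions *)

Definition ltJ (p q : nat * nat) : bool :=
  (p.1 < q.1) || (p.1 == q.1) && (q.2 < p.2).

Lemma leJ_trans : transitive leJ.
Proof. by move=> [a b] [c d] [e f]; rewrite /leJ /=; lia. Qed.

Lemma leJ_total : total leJ.
Proof. by move=> [a b] [c d]; rewrite /leJ /=; lia. Qed.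

Lemma ltJ_trans : transitive ltJ.
Proof. by move=> [a b] [c d] [e f]; rewrite /ltJ /=; lia. Qed.

Lemma ltJ_irr : irreflexive ltJ.
Proof. by move=> [a b]; rewrite /ltJ /=; lia. Qed.

Lemma ltJE p q : ltJ p q = leJ p q && (p != q).
Proof. by case: p q => [a b] [c d]; rewrite /ltJ /leJ xpair_eqE /=; lia. Qed.

Lemma leJNgt p q : leJ p q = ~~ ltJ q p.
Proof. by case: p q => [a b] [c d]; rewrite /ltJ /leJ /=; lia. Qed.

Definition boxes (X : {fset nat * nat}) : seq (nat * nat) := map val (ME_boxes X).

Lemma mem_boxes (X : {fset nat * nat}) p : (p \in boxes X) = (p \in X).
Proof.
apply/mapP/idP => [[x _ ->]|pX]; first exact: valP.
by exists [` pX]%fset => //; rewrite mem_sort mem_enum.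
Qed.

Lemma boxes_uniq X : uniq (boxes X).
Proof. by rewrite map_inj_uniq ?sort_uniq ?enum_uniq //; apply: val_inj. Qed.

Lemma boxes_sorted X : sorted ltJ (boxes X).
Proof.
have /(sort_sorted (leT := fun x y : X => leJ (val x) (val y))) h :
    total (fun x y : X => leJ (val x) (val y)).
  by move=> x y; apply: leJ_total.
have h1 : sorted leJ (boxes X) by rewrite sorted_map; apply: h.
have := boxes_uniq X; rewrite uniq_pairwise.
move: h1; rewrite (sorted_pairwise leJ_trans) (sorted_pairwise ltJ_trans).
move=> h1 h2; have := conj h1 h2 => /andP; rewrite -pairwise_relI.
by apply: sub_pairwise => p q; rewrite /= ltJE.
Qed.

Lemma boxesE X l : sorted ltJ l -> l =i X -> boxes X = l.
Proof.
move=> sl hl; apply: (irr_sorted_eq ltJ_trans ltJ_irr) => //.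
  exact: boxes_sorted.
by move=> p; rewrite mem_boxes hl.
Qed.

(** The type of a filling depends on its diagram; a total function on boxes allows comparison across
    equal diagrams without transport. *)
Definition fval (X : {fset nat * nat}) (F : filling X) (p : nat * nat) : nat :=
  if insub p is Some x then F x else 0.

Lemma fval_val X (F : filling X) (x : X) : fval F (val x) = F x.
Proof. by rewrite /fval valK. Qed.

Lemma eq_fval X (F G : filling X) :
  (forall p, p \in X -> fval F p = fval G p) -> F = G.
Proof.
by move=> h; apply/ffunP => x; rewrite -!fval_val; apply/h/valP.
Qed.

Lemma fval_ffun (X : {fset nat * nat}) (g : nat * nat -> nat) p :
  p \in X -> fval [ffun x : X => g (val x)] p = g p.
Proof.
by move=> pX; rewrite -[p]/(val [` pX]%fset) fval_val ffunE.
Qed.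

Lemma MEE X (F : filling X) : ME F = map (fval F) (boxes X).
Proof.
by rewrite /boxes -map_comp; apply: eq_map => x; rewrite /= fval_val.
Qed.

Lemma S2E X (F : filling X) : S2 F = map (fun p => (p.1, fval F p)) (boxes X).
Proof.
by rewrite /boxes -map_comp; apply: eq_map => x; rewrite /= fval_val.
Qed.

Lemma is_tableauP n X (F : filling X) : is_tableau n F <->
  [/\ forall p, p \in X -> fval F p <= n,
      forall i j j' : nat, (i, j) \in X -> (i, j') \in X -> j <= j' ->
        fval F (i, j) <= fval F (i, j')
    & forall i i' j : nat, (i, j) \in X -> (i', j) \in X -> i < i' ->
        fval F (i, j) < fval F (i', j)].
Proof.
split=> -[h1 h2 h3]; split.
- by move=> p pX; have := h1 [` pX]%fset; rewrite -fval_val.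
- move=> i j j' pX qX jj; have := h2 [` pX]%fset [` qX]%fset.
  by rewrite -!fval_val; apply.
- move=> i i' j pX qX ii; have := h3 [` pX]%fset [` qX]%fset.
  by rewrite -!fval_val; apply.
- by move=> x; rewrite -fval_val; apply/h1/valP.
- move=> x y; have := valP x; have := valP y; rewrite -!fval_val.
  case: (val x) (val y) => [i j] [i' j'] /= hy hx e jj; subst i'; exact: h2.
- move=> x y; have := valP x; have := valP y; rewrite -!fval_val.
  case: (val x) (val y) => [i j] [i' j'] /= hy hx e jj; subst j'; exact: h3.
Qed.

Lemma mem_diagram la p : (p \in diagram la) = (p.2 < nth 0 la p.1).
Proof.
rewrite !inE; apply/allpairsPdep/idP => [[i [j [hi hj ->]]]|h].
  by move: hj; rewrite mem_iota.
exists p.1, p.2; rewrite !mem_iota; split=> //; last by case: p {h}.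
by rewrite /= add0n ltnNge; apply/negP => /(nth_default 0) e; rewrite e in h.
Qed.

Lemma mem_skew la nu p :
  (p \in skew la nu) = (nth 0 la p.1 <= p.2 < nth 0 nu p.1).
Proof. by rewrite inE !mem_diagram -leqNgt. Qed.

Lemma count_boxes_row la nu i (P : pred (nat * nat)) :
  count (fun p => P p && (p.1 == i)) (boxes (skew la nu)) =
  count (fun j => P (i, j)) (iota (nth 0 la i) (skew_row la nu i)).
Proof.
rewrite -count_filter -(count_map (pair i) P).
apply/permP; apply: uniq_perm.
- by rewrite filter_uniq ?boxes_uniq.
- by rewrite map_inj_uniq ?iota_uniq // => x y [].
move=> [i' j]; rewrite mem_filter mem_boxes mem_skew /= /skew_row.
apply/andP/mapP => [[/eqP-> h]|[j' + [-> ->]]].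
  by exists j => //; rewrite mem_iota; lia.
by rewrite mem_iota eqxx; split=> //; lia.
Qed.

Lemma count_iota_gt (P : pred nat) l m j :
  (forall j j', l <= j -> j <= j' -> j' < l + m -> P j' -> P j) ->
  l <= j < l + m -> P j -> j - l < count P (iota l m).
Proof.
move=> hP /andP[lj jm] Pj.
have -> : m = (j - l).+1 + (m - (j - l).+1) by lia.
rewrite iotaD count_cat; apply: leq_trans (leq_addr _ _).
have : all P (iota l (j - l).+1).
  by apply/allP => k; rewrite mem_iota => hk; apply: (hP k j); lia.
by rewrite all_count => /eqP->; rewrite size_iota.
Qed.

Lemma count_iota_leq (P : pred nat) l m j :
  (forall j j', l <= j -> j <= j' -> j' < l + m -> P j' -> P j) ->
  l <= j < l + m -> ~~ P j -> count P (iota l m) <= j - l.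
Proof.
move=> hP /andP[lj jm] Pj.
have -> : m = (j - l) + (m - (j - l)) by lia.
rewrite iotaD count_cat [X in _ + X](_ : _ = 0) ?addn0.
  by rewrite -[X in _ <= X](size_iota l) count_size.
apply/eqP; rewrite -leqn0 leqNgt -has_count; apply/hasPn => k.
rewrite mem_iota => hk; apply: contra Pj; apply: hP; lia.
Qed.

(** Rows increase weakly, so each side is the column where an initial segment ends: the entries at
    most [x] of row [i.+1] must not reach further right than the entries below [x] of row [i]. *)
Lemma columns_strictP la nu (s : nat * nat -> nat) :
  dominant (nth 0 la) -> dominant (nth 0 nu) ->
  (forall i j j' : nat, (i, j) \in skew la nu -> (i, j') \in skew la nu -> j <= j' ->
     s (i, j) <= s (i, j')) ->
  (forall i j : nat, (i, j) \in skew la nu -> (i.+1, j) \in skew la nu ->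
     s (i, j) < s (i.+1, j)) <->
  forall i x,
    nth 0 la i.+1 +
      count (fun j => s (i.+1, j) <= x) (iota (nth 0 la i.+1) (skew_row la nu i.+1))
    <= nth 0 la i +
      count (fun j => s (i, j) < x) (iota (nth 0 la i) (skew_row la nu i)).
Proof.
move=> dla dnu hs.
have mono i (P : pred nat) : (forall x y, x <= y -> P y -> P x) ->
    forall j j', nth 0 la i <= j -> j <= j' ->
    j' < nth 0 la i + skew_row la nu i -> P (s (i, j')) -> P (s (i, j)).
  move=> hP j j' h1 h2; rewrite /skew_row => h3; apply: hP.
  by apply: hs => //; rewrite mem_skew /=; lia.
have mle i x := @mono i (fun y => y <= x) (fun y z => @leq_trans z y x).
have mlt i x := @mono i (fun y => y < x) (fun y z => @leq_ltn_trans z y x).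
split=> h; last first.
  move=> i j h1 h2; rewrite ltnNge; apply/negP => hle.
  have := h i (s (i.+1, j)); rewrite leqNgt => /negP; apply.
  move: h1 h2; rewrite !mem_skew /= => h1 h2.
  have := @count_iota_leq (fun k => s (i, k) < s (i.+1, j)) _ _ j (mlt i _).
  rewrite -leqNgt /skew_row => /(_ _ hle) c1.
  have := @count_iota_gt (fun k => s (i.+1, k) <= s (i.+1, j)) _ _ j (mle i.+1 _).
  rewrite /skew_row => /(_ _ (leqnn _)) c2.
  have {}c1 := c1 ltac:(lia); have {}c2 := c2 ltac:(lia); lia.
move=> i x; set k := count _ _; case: (posnP k) => [->|k0].
  by rewrite addn0; apply: leq_trans (dla i) _; apply: leq_addr.
have km : k <= skew_row la nu i.+1 by rewrite -[X in _ <= X](size_iota (nth 0 la i.+1)) count_size.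
(* The last box of row [i.+1] whose entry is at most [x]. *)
pose j := nth 0 la i.+1 + k.-1.
have sj : s (i.+1, j) <= x.
  rewrite leqNgt; apply/negP => lt.
  have := @count_iota_leq (fun j => s (i.+1, j) <= x) _ _ j (mle i.+1 x).
  rewrite -ltnNge -/k.
  have hj : nth 0 la i.+1 <= j < nth 0 la i.+1 + skew_row la nu i.+1 by rewrite /j; lia.
  by move/(_ hj lt); rewrite /j; lia.
case: (ltnP j (nth 0 la i)) => hj; first by move: hj; rewrite /j; lia.
have hj2 : j < nth 0 nu i.+1 by move: km; rewrite /j /skew_row; lia.
have hj3 := dnu i.
have hsk : s (i, j) < s (i.+1, j).
  by apply: h; rewrite mem_skew /=; move: hj hj2; rewrite /j; lia.
have := @count_iota_gt (fun j => s (i, j) < x) _ (skew_row la nu i) j (mlt i x).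
rewrite (leq_trans hsk sj) /skew_row => /(_ _ isT) c1.
have {}c1 := c1 ltac:(lia); move: c1; rewrite /j; lia.
Qed.

(** * Conjugate shapes, and fillings against lists of columns *)

Lemma ltn_count_conj (s : seq nat) i j : dominant (nth 0 s) ->
  (i < count (fun r => j < r) s) = (j < nth 0 s i).
Proof.
move=> ds; have -> : count (fun r => j < r) s =
    count (fun k => j < nth 0 s k) (iota 0 (size s)).
  by rewrite -{1}(mkseq_nth 0 s) count_map.
have mono k k' : 0 <= k -> k <= k' -> k' < 0 + size s ->
    j < nth 0 s k' -> j < nth 0 s k.
  by move=> _ kk _ /leq_trans; apply; apply: dominant_leq.
apply/idP/idP => [h|h].
  rewrite ltnNge; apply/negP => hj; move: h; rewrite ltnNge => /negP; apply.
  case: (ltnP i (size s)) => hi.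
    have := @count_iota_leq (fun k => j < nth 0 s k) 0 (size s) i mono.
    by rewrite subn0 -leqNgt; apply.
  by apply: leq_trans hi; rewrite -[X in _ <= X](size_iota 0) count_size.
have hi : i < size s by rewrite ltnNge; apply/negP => /(nth_default 0) e; rewrite e in h.
have := @count_iota_gt (fun k => j < nth 0 s k) 0 (size s) i mono.
by rewrite subn0; apply.
Qed.

Lemma dominant_shape T : col_tableau T -> dominant (nth 0 (map size T)).
Proof.
case/andP=> _ sT i; rewrite !shape_nth.
case: (ltnP i.+1 (size T)) => hi; last by rewrite nth_default.
by have /(sortedP [::])/(_ i hi)/col_leP[] := sT.
Qed.

Lemma nth_shape_of T i : col_tableau T ->
  nth 0 (shape_of T) i = count (fun c => i < size c) T.
Proof.
move=> tT; case: (ltnP i (size (head [::] T))) => hi; first by rewrite nth_mkseq.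
rewrite nth_default ?size_mkseq //; apply/esym/eqP.
rewrite -(count_map size (fun r => i < r)) -leqn0 leqNgt ltn_count_conj; last exact: dominant_shape.
by rewrite shape_nth nth0 -leqNgt.
Qed.

Lemma ltn_shape_of T i j : col_tableau T ->
  (j < nth 0 (shape_of T) i) = (i < size (nth [::] T j)).
Proof.
move=> tT; rewrite nth_shape_of // -(count_map size (fun r => i < r)).
by rewrite ltn_count_conj ?shape_nth //; apply: dominant_shape.
Qed.

Lemma eq_ltn m n : (forall j, (j < m) = (j < n)) -> m = n.
Proof.
move=> h; by apply/eqP; rewrite eqn_leq leqNgt h ltnn /= leqNgt -h ltnn.
Qed.

Lemma is_young_shape_of T : col_tableau T -> is_young (shape_of T).
Proof.
move=> tT; apply/is_youngP; split=> [i|].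
  by rewrite !nth_shape_of //; apply: sub_count => c; apply: ltnW.
apply/notin0P => i; rewrite size_mkseq => hi.
by rewrite ltn_shape_of // nth0.
Qed.

Lemma boxes_diagram mu : boxes (diagram mu) =
  flatten [seq [seq (i, j) | j <- rev (iota 0 (nth 0 mu i))] | i <- iota 0 (size mu)].
Proof.
apply: boxesE; last first.
  case=> i j; rewrite mem_diagram; apply/flattenP/idP.
    case=> _ /mapP[i' _ ->] /mapP[j' + [-> ->]].
    by rewrite mem_rev mem_iota.
  move=> /= h; exists [seq (i, j) | j <- rev (iota 0 (nth 0 mu i))].
    apply/mapP; exists i => //; rewrite mem_iota /=.
    by rewrite add0n ltnNge; apply/negP => /(nth_default 0) e; rewrite e in h.
  by apply/mapP; exists j => //; rewrite mem_rev mem_iota.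
rewrite (sorted_pairwise ltJ_trans); elim: (size mu) => // m IHm.
rewrite -[m.+1]addn1 iotaD map_cat flatten_cat /= cats0 add0n pairwise_cat IHm /=.
apply/andP; split.
  apply/allrelP => p q /flattenP[_ /mapP[i + ->]] /mapP[j _ ->] /mapP[j' _ ->].
  by rewrite mem_iota /ltJ /= add0n => ->.
rewrite -(sorted_pairwise ltJ_trans) sorted_map rev_sorted.
apply: sub_sorted (iota_ltn_sorted 0 _) => x y /= xy.
by rewrite /ltJ /= ltnn eqxx xy.
Qed.

Lemma size_boxes_diagram mu : size (boxes (diagram mu)) = sumn mu.
Proof.
rewrite boxes_diagram size_flatten /shape -map_comp -[in RHS](mkseq_nth 0 mu).
congr sumn; apply: eq_map => i /=; by rewrite size_map size_rev size_iota.
Qed.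

Lemma filter_take_col (p : pred (seq nat)) T : col_tableau T ->
  (forall c d, col_le c d -> p d -> p c) ->
  [seq c <- T | p c] = take (count p T) T.
Proof.
move=> + hp; elim: T => // c T IHT; rewrite col_tableau_cons /=.
case/and4P=> _ _ tT /allP cT; case: ifPn => hc /=; first by rewrite IHT.
have /hasPn h : forall d, d \in T -> ~~ p d.
  by move=> d /cT cd; apply: contra hc; apply: hp.
move: (h); rewrite has_filter negbK => /eqP ->.
by move: h; rewrite has_count -leqNgt leqn0 => /eqP ->.
Qed.

Definition col_entry (T : seq (seq nat)) (p : nat * nat) : nat :=
  nth 0 (nth [::] T p.2) p.1.

Lemma ME_row_word mu T (F : filling (diagram mu)) : col_tableau T ->
  shape_of T = mu ->
  (forall p, p \in diagram mu -> fval F p = col_entry T p) ->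
  ME F = row_word T.
Proof.
move=> tT emu hF; subst mu; rewrite MEE.
have -> : map (fval F) (boxes (diagram (shape_of T))) =
    map (col_entry T) (boxes (diagram (shape_of T))).
  by apply/eq_in_map => p; rewrite mem_boxes => /hF.
rewrite boxes_diagram map_flatten -map_comp /row_word size_mkseq.
congr flatten; apply: eq_map => i /=.
rewrite -map_comp map_rev nth_shape_of // /row_rev filter_take_col //; last first.
  by move=> c d /col_leP[h _] /leq_trans; apply.
by rewrite -(map_nth_iota0 [::]) ?count_size // -map_comp.
Qed.

Lemma is_tableau_cols n mu T (F : filling (diagram mu)) : col_tableau T ->
  shape_of T = mu ->
  (forall p, p \in diagram mu -> fval F p = col_entry T p) ->
  all (fun x => x <= n) (ME F) -> is_tableau n F.
Proof.
move=> tT emu hF hn; subst mu; apply/is_tableauP; split.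
- move=> p pX; apply: (allP hn); rewrite MEE; apply: map_f.
  by rewrite mem_boxes.
- move=> i j j' h1 h2; rewrite !hF // leq_eqVlt => /predU1P[->//|jj].
  move: h1 h2; rewrite !mem_diagram /= !ltn_shape_of // /col_entry /= => h1 h2.
  have hj : j' < size T by rewrite ltnNge; apply/negP => h; rewrite nth_default in h2.
  have /andP[_ sT] := tT.
  have := path.sorted_ltn_nth col_le_trans [::] sT.
  move=> /(_ j j'); rewrite !inE hj (ltn_trans jj hj) => /(_ isT isT jj).
  by case/col_leP=> _; apply.
move=> i i' j h1 h2; rewrite !hF //; move: h1 h2; rewrite !mem_diagram /=.
rewrite !ltn_shape_of // /col_entry /= => h1 h2; apply: col_ltn_nth => //.
have hj : j < size T by rewrite ltnNge; apply/negP => h; rewrite nth_default in h2.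
by apply: (allP (col_tableau_sorted tT)); apply: mem_nth.
Qed.

Lemma tableau_cols n mu (F : filling (diagram mu)) : is_young mu ->
  is_tableau n F -> exists T, [/\ col_tableau T, shape_of T = mu &
    forall p, p \in diagram mu -> fval F p = col_entry T p].
Proof.
move=> /is_youngP[dmu mu0] /is_tableauP[_ hr hc].
pose ht j := count (fun r => j < r) mu.
pose col j := mkseq (fun i => fval F (i, j)) (ht j).
pose T := mkseq col (nth 0 mu 0).
have sz i j : (i < size (nth [::] T j)) = (j < nth 0 mu i).
  case: (ltnP j (nth 0 mu 0)) => hj.
    by rewrite nth_mkseq // size_mkseq ltn_count_conj.
  rewrite nth_default ?size_mkseq // ltn0; apply/esym/negbTE; rewrite -leqNgt.
  exact: leq_trans (dominant_leq dmu (leq0n i)) hj.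
have ent i j : j < nth 0 mu i -> nth 0 (nth [::] T j) i = fval F (i, j).
  move=> hj; have hj0 := leq_trans hj (dominant_leq dmu (leq0n i)).
  by rewrite nth_mkseq // nth_mkseq // ltn_count_conj.
have tT : col_tableau T.
  apply/andP; split.
    apply/(all_nthP [::]) => j; rewrite size_mkseq => hj; apply/andP; split.
      apply/(sortedP 0) => i; rewrite sz => hi.
      have hi' := leq_trans hi (dmu i).
      by rewrite /= !ent //; apply: hc; rewrite ?mem_diagram.
    by rewrite -size_eq0 -lt0n sz.
  apply/(sortedP [::]) => j _; apply/col_leP; split.
    rewrite leqNgt; apply/negP => h; have := h; rewrite sz => /ltnW.
    by rewrite -sz ltnn.
  move=> i; rewrite sz => hi; rewrite !ent //; last exact: ltnW.
  by apply: hr; rewrite ?mem_diagram //= ltnW.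
exists T; split=> //.
  have /is_youngP[_ s0] := is_young_shape_of tT.
  apply: eq_nth_notin0 => // i; apply: eq_ltn => j.
  by rewrite ltn_shape_of.
by case=> i j; rewrite mem_diagram => hj; rewrite /col_entry ent.
Qed.

Lemma new_boxes_rcons T s x : new_boxes T (rcons s x) =
  rcons (new_boxes T s) (new_box x (foldl (fun U y => col_insert y U) T s)).
Proof. by elim: s T => //= y s IHs T; rewrite IHs. Qed.

Lemma size_new_boxes T s : size (new_boxes T s) = size s.
Proof. by elim: s T => //= y s IHs T; rewrite IHs. Qed.

Lemma mem_new_boxes s i j :
  ((i, j) \in new_boxes [::] s) = (i < size (nth [::] (col_bumping s) j)).
Proof.
elim/last_ind: s => [|s x IHs]; first by rewrite nth_nil.
rewrite new_boxes_rcons -/(col_bumping s) mem_rcons inE IHs col_bumping_rcons.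
rewrite new_boxE xpair_eqE -(shape_nth (col_insert _ _)) shape_col_insert nth_incr /add_at shape_nth.
by case: (eqVneq j (new_col x _)) => [->|_] /=; rewrite ?andbT ?andbF; lia.
Qed.

Lemma recording_entry w i j : i < size (nth [::] (rsk w).1 j) ->
  nth 0 (unzip1 w) (index (i, j) (new_boxes [::] (unzip2 w))) =
  nth 0 (nth [::] (rsk w).2 j) i.
Proof.
elim/last_ind: w i j => [|w [b a] IHw] i j; first by rewrite nth_nil.
have sh k : size (nth [::] (rsk w).2 k) = size (nth [::] (rsk w).1 k).
  by rewrite -!shape_nth rsk_shape.
rewrite rsk_rcons /= -shape_nth shape_col_insert nth_incr /add_at shape_nth.
rewrite /unzip1 /unzip2 !map_rcons new_boxes_rcons -/(col_bumping _) /=.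
rewrite -[map snd w]/(unzip2 w) -[map fst w]/(unzip1 w).
rewrite new_boxE -[rcons (new_boxes _ _) _]cats1 index_cat mem_new_boxes -rsk_col_bumping nth_add_rec.
have szw : size (unzip1 w) = size (new_boxes [::] (unzip2 w)).
  by rewrite size_new_boxes !size_map.
set k := new_col a _ => hi; case: ifP => hij.
  rewrite nth_rcons szw index_mem mem_new_boxes -rsk_col_bumping hij IHw //.
  by case: eqP => // <-; rewrite nth_rcons sh hij.
have jk : j = k by case: eqP hi => // _; rewrite addn0 hij.
rewrite jk eqxx in hi hij *.
have ei : i = size (nth [::] (rsk w).1 k) by lia.
by rewrite ei /= !eqxx addn0 !nth_rcons szw ltnn eqxx sh ltnn eqxx.
Qed.

(** * Pictures *)

Lemma count_ltn (T : eqType) (P Q : pred T) s x : subpred P Q ->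
  x \in s -> Q x -> ~~ P x -> count P s < count Q s.
Proof.
move=> PQ; elim: s => //= y s IHs; rewrite inE => /predU1P[->|xs] Qx Px.
  rewrite Qx (negbTE Px) add0n add1n ltnS; exact: sub_count.
have := IHs xs Qx Px; have : P y <= Q y by case: (boolP (P y)) => // /PQ ->.
lia.
Qed.

Section BoxWords.
Variables (l : seq (nat * nat)) (s : nat * nat -> nat).

(** Added to the starting length of row [i], this is the length of that row just before the letter
    of [p] is read. *)
Definition count_before (i : nat) (p : nat * nat) : nat :=
  count (fun q => (s q == i) && ltJ q p) l.

Lemma count_before_lt i p q : p \in l -> s p = i -> ltJ p q ->
  count_before i p < count_before i q.
Proof.
move=> pl sp pq; apply: (@count_ltn _ _ _ _ p) => //; last first.
- by rewrite ltJ_irr andbF.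
- by rewrite sp eqxx pq.
by move=> r /andP[-> /ltJ_trans]; apply.
Qed.

Lemma count_before_leq i p q : leJ p q -> count_before i p <= count_before i q.
Proof.
move=> pq; apply: sub_count => r /= /andP[-> rp] /=.
by move: pq rp; case: p q r => [a b] [c d] [e f]; rewrite /leJ /ltJ /=; lia.
Qed.

End BoxWords.

Arguments count_before : simpl never.

Lemma dominant_word_boxes l s g : sorted ltJ l ->
  dominant_word g (map s l) <->
  forall p, p \in l -> (s p == 0) ||
    (g (s p) + count_before l s (s p) p < g (s p).-1 + count_before l s (s p).-1 p).
Proof.
rewrite (sorted_pairwise ltJ_trans).
elim: l g => [|p l IHl] g //= /andP[/allP pl sl].
have cb i q : q \in l ->
    g i + count_before (p :: l) s i q = add_at g (s p) i + count_before l s i q.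
  by move=> /pl pq; rewrite /count_before /= pq andbT /add_at eq_sym addnA.
have cp i : count_before (p :: l) s i p = 0.
  apply/eqP; rewrite -leqn0 leqNgt -has_count; apply/hasPn => q.
  rewrite inE => /predU1P[->|/pl pq]; first by rewrite ltJ_irr andbF.
  apply/negP => /andP[_ qp]; have := ltJ_trans pq qp; by rewrite ltJ_irr.
split=> [/andP[hp /(IHl _ sl) hl] q|h].
  rewrite inE => /predU1P[->|ql]; first by rewrite !cp !addn0.
  by rewrite !cb //; apply: hl.
have := h p; rewrite inE eqxx !cp !addn0 => -> //=.
by apply/IHl => // q ql; rewrite -!cb //; apply: h; rewrite inE ql orbT.
Qed.

Lemma dominant_before l s g p : sorted ltJ l -> dominant g ->
  dominant_word g (map s l) -> p \in l ->
  dominant (fun i => g i + count_before l s i p).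
Proof.
rewrite (sorted_pairwise ltJ_trans) => + + + pinl.
have [l1 [l2 [-> _]]] := split_first pinl.
rewrite pairwise_cat map_cat dominant_word_cat /= => /and3P[/allrelP h _ /andP[hp _]].
move=> dg /andP[/(dominant_word_dominant dg) d1 _] i.
suff e j : count_before (l1 ++ p :: l2) s j p = count_mem j (map s l1).
  by rewrite !e; apply: d1.
rewrite /count_before count_cat /= ltJ_irr andbF add0n count_map.
rewrite [X in _ + X](_ : _ = 0) ?addn0; last first.
  apply/eqP; rewrite -leqn0 leqNgt -has_count; apply/hasPn => q /(allP hp) pq.
  apply/negP => /andP[_ qp]; have := ltJ_trans pq qp; by rewrite ltJ_irr.
apply: eq_in_count => q hq /=.
by rewrite (h q p) ?andbT // inE eqxx.
Qed.

Section Pictures.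
Variables (X Y : {fset nat * nat}).

Definition pval (f : {ffun X -> Y}) (p : nat * nat) : nat * nat :=
  if insub p is Some x then val (f x) else (0, 0).

Lemma pval_val f (x : X) : pval f (val x) = val (f x).
Proof. by rewrite /pval valK. Qed.

Lemma fval_S1 f p : p \in X -> fval (S1 f) p = (pval f p).1.
Proof. by move=> pX; rewrite -[p]/(val [` pX]%fset) fval_val ffunE pval_val. Qed.

Lemma pictureP f : pictures X Y f -> exists g : nat * nat -> nat * nat,
  [/\ forall p, p \in X -> pval f p \in Y /\ g (pval f p) = p,
      forall y, y \in Y -> g y \in X /\ pval f (g y) = y,
      {in X &, forall p q, Defs.leP p q -> leJ (pval f p) (pval f q)}
    & {in Y &, forall y z, Defs.leP y z -> leJ (g y) (g z)}].
Proof.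
case=> g [fg gf sf sg].
exists (fun y => if insub y is Some z then val (g z) else (0, 0)); split.
- move=> p pX; rewrite -[p]/(val [` pX]%fset) pval_val; split; first exact: valP.
  by rewrite valK fg.
- move=> y yY; rewrite -[y]/(val [` yY]%fset) valK pval_val gf; split=> //.
  exact: valP.
- move=> p q pX qX; rewrite -[p]/(val [` pX]%fset) -[q]/(val [` qX]%fset).
  by rewrite !pval_val; apply: sf.
move=> p q pX qX; rewrite -[p]/(val [` pX]%fset) -[q]/(val [` qX]%fset).
by rewrite !valK; apply: sg.
Qed.

End Pictures.

Section S1Bijection.
Variables (n : nat) (la1 nu1 la2 nu2 : seq nat).
Hypotheses (yla1 : is_young la1) (ynu1 : is_young nu1).
Hypotheses (yla2 : is_young la2) (ynu2 : is_young nu2) (in2 : incl_young la2 nu2).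
Hypothesis (rows2 : size nu2 <= n).
Local Notation X := (skew la1 nu1).
Local Notation Y := (skew la2 nu2).

Lemma skew_corner i i' j j' : (i, j) \in X -> (i', j') \in X -> i <= i' -> j <= j' ->
  (i', j) \in X.
Proof.
move: yla1 ynu1 => /is_youngP[d1 _] /is_youngP[d2 _].
rewrite !mem_skew /= => h1 h2 ii jj.
have := dominant_leq d1 ii; lia.
Qed.

Section Image.
Variables (f : {ffun X -> Y}) (pf : pictures X Y f).
Let phi := pval f.
Let S := fval (S1 f).

Lemma perm_pval : perm_eq (map phi (boxes X)) (boxes Y).
Proof.
have [g [hp hg _ _]] := pictureP pf.
apply: uniq_perm; last first.
- move=> y; rewrite mem_boxes; apply/mapP/idP => [[p]|yY].
    by rewrite mem_boxes => /hp[? _] ->.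
  by have [gX e] := hg _ yY; exists (g y); rewrite ?mem_boxes.
- exact: boxes_uniq.
rewrite map_inj_in_uniq ?boxes_uniq // => p q; rewrite !mem_boxes => pX qX e.
by have [_ <-] := hp _ pX; have [_ <-] := hp _ qX; rewrite -/phi e.
Qed.

Lemma count_row_S1 i (P : pred (nat * nat)) (Q : pred (nat * nat)) :
  (forall p, p \in X -> Q p = P (phi p)) ->
  count (fun p => (S p == i) && Q p) (boxes X) =
  count (fun j => P (i, j)) (iota (nth 0 la2 i) (skew_row la2 nu2 i)).
Proof.
move=> PQ; rewrite -count_boxes_row -(permP perm_pval) (count_map phi).
apply: eq_in_count => p; rewrite mem_boxes => pX /=.
by rewrite /S fval_S1 // PQ // andbC.
Qed.

(** Since the inverse of [f] is PJ-standard, each row of [Y] is filled from left to right as [X] is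
    read, and a box is filled only after the box above it. So [f] sends [p] to the box that its
    letter adds. *)
Lemma pval_count p : p \in X ->
  phi p = (S p, nth 0 la2 (S p) + count_before (boxes X) S (S p) p) /\
  ((S p == 0) || (nth 0 la2 (S p) + count_before (boxes X) S (S p) p <
     nth 0 la2 (S p).-1 + count_before (boxes X) S (S p).-1 p)).
Proof.
move=> pX; have [g [hp hg sf sg]] := pictureP pf.
have cb i : count_before (boxes X) S i p =
    count (fun j => ltJ (g (i, j)) p) (iota (nth 0 la2 i) (skew_row la2 nu2 i)).
  apply: (@count_row_S1 i (fun y => ltJ (g y) p)) => q qX.
  by have [_ ->] := hp _ qX.
have mono i j j' : nth 0 la2 i <= j -> j <= j' ->
    j' < nth 0 la2 i + skew_row la2 nu2 i -> ltJ (g (i, j')) p -> ltJ (g (i, j)) p.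
  rewrite /skew_row => h1 h2 h3 h4.
  have := sg (i, j) (i, j'); rewrite !mem_skew /Defs.leP /= leqnn h2.
  have {h1 h3}[-> ->] : nth 0 la2 i <= j < nth 0 nu2 i /\ nth 0 la2 i <= j' < nth 0 nu2 i by lia.
  move=> /(_ isT isT isT); move: h4.
  by case: (g (i, j)) (g (i, j')) p {pX cb} => [a b] [c d] [e h]; rewrite /ltJ /leJ /=; lia.
have [phiY gphi] := hp _ pX; have eS : S p = (phi p).1 by rewrite /S fval_S1.
move: phiY; rewrite -/phi (surjective_pairing (phi p)) -eS mem_skew /=.
rewrite -/phi (surjective_pairing (phi p)) -eS in gphi.
move: (phi p).2 gphi => c gphi hc.
have cb1 : count_before (boxes X) S (S p) p = c - nth 0 la2 (S p).
  apply/eqP; rewrite eqn_leq cb; apply/andP; split.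
    apply: count_iota_leq; [exact: mono|by rewrite /skew_row; lia|].
    by rewrite gphi ltJ_irr.
  case: (posnP (c - nth 0 la2 (S p))) => [->//|c0].
  have -> : c - nth 0 la2 (S p) = (c.-1 - nth 0 la2 (S p)).+1 by lia.
  apply: count_iota_gt; [exact: mono|by rewrite /skew_row; lia|].
  have h : (S p, c.-1) \in Y by rewrite mem_skew /=; lia.
  have h' : (S p, c) \in Y by rewrite mem_skew.
  have := sg _ _ h h'; rewrite gphi /Defs.leP /= leqnn leq_pred => /(_ isT) le.
  rewrite ltJE le /=.
  apply/eqP => e; have [_] := hg _ h; rewrite e.
  by have [_] := hg _ h'; rewrite gphi => -> []; lia.
split; first by rewrite cb1; congr pair; lia.
case: (posnP (S p)) => //= Sp0; rewrite cb1.
have -> : nth 0 la2 (S p) + (c - nth 0 la2 (S p)) = c by lia.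
(* The box above is either in [la2] or in [Y]; in the second case its preimage is read before
   [p]. *)
case: (ltnP c (nth 0 la2 (S p).-1)) => hc1; first exact: ltn_addr.
have /is_youngP[dnu _] := ynu2; have := dnu (S p).-1; rewrite prednK // => dn.
have h : ((S p).-1, c) \in Y by rewrite mem_skew /=; lia.
have h' : (S p, c) \in Y by rewrite mem_skew.
suff : c - nth 0 la2 (S p).-1 < count_before (boxes X) S (S p).-1 p by lia.
rewrite cb; apply: count_iota_gt; [exact: mono|by rewrite /skew_row; lia|].
have := sg _ _ h h'; rewrite gphi /Defs.leP /= leqnn leq_pred => /(_ isT) le.
rewrite ltJE le /=.
apply/eqP => e; have [_] := hg _ h; rewrite e.
by have [_] := hg _ h'; rewrite gphi => -> []; lia.
Qed.

Lemma S1_image : LR_skew_tableaux n X la2 nu2 (S1 f).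
Proof.
have [g [hp hg sf sg]] := pictureP pf.
have cnt i : count_mem i (ME (S1 f)) = skew_row la2 nu2 i.
  rewrite MEE count_map -[RHS](size_iota (nth 0 la2 i)) -(count_predT (iota _ _)).
  rewrite -(@count_row_S1 i predT predT) //.
  by apply: eq_count => p; rewrite /= andbT.
have lr : LR_word la2 nu2 (ME (S1 f)).
  apply/LR_wordP => //; split=> //; rewrite MEE.
  apply/dominant_word_boxes; first exact: boxes_sorted.
  by move=> p; rewrite mem_boxes => /pval_count[].
split=> //; apply/is_tableauP; split.
- move=> p pX; apply: (allP (LR_word_leq rows2 lr)).
  by rewrite MEE map_f // mem_boxes.
- move=> i j j' h1 h2 jj; rewrite !fval_S1 //.
  have := sf _ _ h1 h2; rewrite /Defs.leP /= leqnn jj => /(_ isT).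
  by rewrite /leJ; lia.
move=> i i' j h1 h2 ii; rewrite !fval_S1 //.
have := sf _ _ h1 h2; rewrite /Defs.leP /= leqnn (ltnW ii) => /(_ isT) /orP[//|].
(* With equal image rows, the image of the lower box would be weakly left of the other, and the
   inverse would put the lower box first in the reading. *)
case/andP=> /eqP e1 e2; have [y1 g1] := hp _ h1; have [y2 g2] := hp _ h2.
have := sg _ _ y2 y1; rewrite g1 g2 /Defs.leP e1 leqnn e2 => /(_ isT).
by rewrite /leJ /=; lia.
Qed.

End Image.

Lemma S1_inj : set_inj (pictures X Y) (@S1 X Y).
Proof.
move=> f f' /set_mem pf /set_mem pf' e; apply/ffunP => x; apply: val_inj.
have xX := valP x; rewrite -!pval_val.
have [-> _] := pval_count pf xX; have [-> _] := pval_count pf' xX.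
by rewrite e.
Qed.

Lemma S1_surj : #|` X| = #|` Y| ->
  set_surj (pictures X Y) (LR_skew_tableaux n X la2 nu2) (@S1 X Y).
Proof.
move=> cXY S [/is_tableauP[_ hr hc] cnt /LR_wordP []// hd _].
have /is_youngP[dla _] := yla2; have /is_youngP[dnu _] := ynu2.
pose s := fval S; pose cb := count_before (boxes X) s.
pose phi p := (s p, nth 0 la2 (s p) + cb (s p) p).
have phiY p : p \in X -> phi p \in Y.
  move=> pX; rewrite mem_skew /= leq_addr /=.
  have := cnt (s p); rewrite MEE count_map /skew_row => h.
  suff : cb (s p) p < count (preim s (pred1 (s p))) (boxes X).
    by rewrite h; have := in2 (s p); lia.
  apply: (@count_ltn _ _ _ _ p) => /=; rewrite ?mem_boxes ?eqxx ?ltJ_irr //.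
  by move=> q /andP[].
have phi_lt p q : q \in X -> ltJ q p -> s p = s q -> (phi q).2 < (phi p).2.
  move=> qX qp e; rewrite /= e ltn_add2l; apply: count_before_lt => //.
  by rewrite mem_boxes.
have phi_inj : {in X &, injective phi}.
  move=> p q pX qX e; apply/eqP; apply/negPn/negP => ne.
  have es : s p = s q by case: e.
  case/orP: (leJ_total p q) => h.
    by have := phi_lt q p pX; rewrite ltJE h ne e ltnn => /(_ isT (esym es)).
  by have := phi_lt p q qX; rewrite ltJE h eq_sym ne e ltnn => /(_ isT es).
have phi_std p q : p \in X -> q \in X -> Defs.leP p q -> leJ (phi p) (phi q).
  case: p q => [i j] [i' j'] pX qX /andP[/= ii jj].
  (* The corner [(i', j)] shares a column with [p] and a row with [q], so column and row conditions
     compare [s p] with [s q]. *)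
  have qX' := skew_corner pX qX ii jj.
  have le2 := hr _ _ _ qX' qX jj; rewrite -/s in le2.
  move: ii; rewrite leq_eqVlt => /predU1P[ei|lt].
    subst i'; move: le2; rewrite leq_eqVlt => /predU1P[e|lt]; last by rewrite /leJ /= lt.
    rewrite /leJ /= e eqxx leq_add2l; apply/orP; right.
    by apply: count_before_leq; rewrite /leJ /= eqxx jj orbT.
  by rewrite /leJ /= (leq_trans (hc _ _ _ pX qX' lt) le2).
have phi_std' p q : p \in X -> q \in X -> Defs.leP (phi p) (phi q) -> leJ p q.
  move=> pX qX /andP[h1 h2]; rewrite leJNgt; apply/negP => qp.
  move: h1; rewrite leq_eqVlt => /predU1P[e|lt].
    by have := phi_lt p q qX qp e; rewrite ltnNge h2.
  rewrite /= in lt h2.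
  have qB : q \in boxes X by rewrite mem_boxes.
  (* Suppose [q] is read before [p] and [s p < s q]. Before [q], row [s p] is at least as long as
     row [(s q).-1], hence longer than column index [(phi q).2]; it cannot shrink before [p],
     against [(phi p).2 <= (phi q).2]. *)
  rewrite MEE in hd; have db := dominant_before (boxes_sorted X) dla hd qB.
  have /dominant_word_boxes h := hd; have := h (boxes_sorted X) q qB.
  rewrite gtn_eqF ?(leq_ltn_trans _ lt) //= -/s -/(cb _ _) -/(cb _ _) => h3.
  have h4 : s p <= (s q).-1 by lia.
  have := dominant_leq db h4; rewrite -/s -/(cb _ _) -/(cb _ _) => h5.
  have := @count_before_leq (boxes X) s (s p) q p.
  rewrite -/(cb _ _) -/(cb _ _); move: qp; rewrite ltJE => /andP[-> _] /(_ isT); lia.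
pose f : {ffun X -> Y} := [ffun x => [` phiY (val x) (valP x)]%fset].
have fE x : val (f x) = phi (val x) by rewrite ffunE.
have f_inj : injective f.
  move=> x y e; apply/val_inj/phi_inj; try exact: valP.
  by rewrite -!fE e.
have [|g fg gf] := inj_card_bij f_inj; first by rewrite -!cardfE cXY.
exists f; last by apply: eq_fval => p pX; rewrite fval_S1 // -[p]/(val [` pX]%fset) pval_val fE.
exists g; split=> //.
- by move=> x y h; rewrite !fE; apply: phi_std => //; apply: valP.
move=> y z h; apply: phi_std'; try exact: valP.
by rewrite -!fE !gf.
Qed.

End S1Bijection.

(** * Arrays *)

Lemma eq_shape T T' : col_tableau T -> col_tableau T' ->
  shape_of T = shape_of T' <-> map size T = map size T'.
Proof.
move=> tT tT'; split=> e.
  apply: eq_nth_notin0; rewrite ?shape_notin0 // => j; apply: eq_ltn => i.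
  by rewrite !shape_nth -!ltn_shape_of // e.
have /is_youngP[_ s0] := is_young_shape_of tT.
have /is_youngP[_ s0'] := is_young_shape_of tT'.
apply: eq_nth_notin0 => // i; apply: eq_ltn => j.
by rewrite !ltn_shape_of // -!shape_nth e.
Qed.

Lemma eq_col_entry T T' : col_tableau T -> col_tableau T' ->
  shape_of T = shape_of T' ->
  (forall p, p \in diagram (shape_of T) -> col_entry T p = col_entry T' p) ->
  T = T'.
Proof.
move=> tT tT' es he; have es' : map size T = map size T' by apply/eq_shape.
apply: (@eq_from_nth _ [::]) => [|j _]; first by rewrite -!(size_map size) es'.
have sj : size (nth [::] T j) = size (nth [::] T' j) by rewrite -!shape_nth es'.
apply: (@eq_from_nth _ 0) => // i hi; apply: (he (i, j)).
by rewrite mem_diagram ltn_shape_of.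
Qed.

Definition swap_array (w : seq (nat * nat)) : seq (nat * nat) :=
  sort lex_le (map swap_pair w).

Lemma swap_array_lexicographic w : lexicographic (swap_array w).
Proof. exact: sort_sorted lex_le_total _. Qed.

Lemma perm_swap_array w : perm_eq (swap_array w) (map swap_pair w).
Proof. by rewrite perm_sort. Qed.

Lemma perm_unzip2_swap_array w : perm_eq (unzip2 (swap_array w)) (unzip1 w).
Proof.
by rewrite (perm_trans (perm_map _ (perm_swap_array w))) // -map_comp.
Qed.

Section Fillings.
Variables (w : seq (nat * nat)).
Hypothesis lw : lexicographic w.
Local Notation mu := (shape_of (col_bumping (unzip2 w))).

Lemma rsk_swap_array : (rsk w).2 = col_bumping (unzip2 (swap_array w)).
Proof.
rewrite -rsk_col_bumping.
by rewrite (rsk_swap lw (swap_array_lexicographic w) (perm_swap_array w)).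
Qed.

Lemma col_tableau_rec : col_tableau (rsk w).2.
Proof. by rewrite rsk_swap_array col_tableau_bumping. Qed.

Lemma shape_of_rec : shape_of (rsk w).2 = mu.
Proof.
rewrite -rsk_col_bumping; apply/eq_shape; rewrite ?rsk_shape //.
  exact: col_tableau_rec.
exact: rsk_tableau.
Qed.

Lemma fval_bumping p : p \in diagram mu ->
  fval (bumping_filling mu (unzip2 w)) p = col_entry (rsk w).1 p.
Proof.
move=> pX; rewrite rsk_col_bumping.
exact: (fval_ffun (col_entry (col_bumping (unzip2 w)))).
Qed.

Lemma fval_recording p : p \in diagram mu ->
  fval (recording_filling mu (unzip1 w) (unzip2 w)) p = col_entry (rsk w).2 p.
Proof.
case: p => i j pX.
rewrite (fval_ffun (fun p => nth 0 (unzip1 w) (index p (new_boxes [::] (unzip2 w))))) //.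
apply: recording_entry; rewrite -ltn_shape_of ?rsk_tableau // rsk_col_bumping.
by rewrite mem_diagram in pX.
Qed.

Lemma LR_equiv_bumping :
  LR_equiv (unzip2 w) (ME (bumping_filling mu (unzip2 w))).
Proof.
rewrite (ME_row_word (rsk_tableau w) _ fval_bumping) rsk_col_bumping //.
apply: LR_equiv_trans (LR_equiv_col_bumping _) _.
exact/LR_equiv_sym/LR_equiv_row_word/col_tableau_bumping.
Qed.

Lemma LR_equiv_recording : LR_equiv (unzip2 (swap_array w))
  (ME (recording_filling mu (unzip1 w) (unzip2 w))).
Proof.
rewrite (ME_row_word col_tableau_rec shape_of_rec fval_recording) rsk_swap_array.
apply: LR_equiv_trans (LR_equiv_col_bumping _) _.
exact/LR_equiv_sym/LR_equiv_row_word/col_tableau_bumping.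
Qed.

Lemma LR_crystal_bumping n la nu : is_young la -> size nu <= n ->
  LR_crystal n mu la nu (bumping_filling mu (unzip2 w)) <->
  LR_word la nu (unzip2 w).
Proof.
move=> yla hn; split=> [[_]|/(LR_word_equiv yla LR_equiv_bumping) h].
  exact/LR_word_equiv/LR_equiv_sym/LR_equiv_bumping.
split=> //; apply: is_tableau_cols (rsk_tableau w) _ fval_bumping _.
  by rewrite rsk_col_bumping.
exact: LR_word_leq h.
Qed.

Lemma LR_crystal_recording n la nu : is_young la -> size nu <= n ->
  LR_crystal n mu la nu (recording_filling mu (unzip1 w) (unzip2 w)) <->
  LR_word la nu (unzip2 (swap_array w)).
Proof.
move=> yla hn; split=> [[_]|/(LR_word_equiv yla LR_equiv_recording) h].
  exact/LR_word_equiv/LR_equiv_sym/LR_equiv_recording.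
split=> //; apply: is_tableau_cols col_tableau_rec shape_of_rec fval_recording _.
exact: LR_word_leq h.
Qed.

Lemma sumn_shape : sumn mu = size w.
Proof.
have [/perm_size + _] := LR_equiv_bumping.
by rewrite MEE (size_map (fval _)) size_boxes_diagram size_map.
Qed.

End Fillings.

Lemma eq_pair_fillings mu mu' (F : pair_fillings mu) (F' : pair_fillings mu') :
  mu = mu' ->
  (forall p, p \in diagram mu -> fval F.1 p = fval F'.1 p) ->
  (forall p, p \in diagram mu -> fval F.2 p = fval F'.2 p) ->
  existT pair_fillings mu F = existT pair_fillings mu' F'.
Proof.
move=> e; subst mu'; case: F F' => [F1 F2] [G1 G2] /= h1 h2.
by rewrite (eq_fval h1) (eq_fval h2).
Qed.

Section Arrays.
Variables (n N : nat) (la1 nu1 la2 nu2 : seq nat).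
Hypotheses (yla1 : is_young la1) (ynu1 : is_young nu1) (in1 : incl_young la1 nu1).
Hypotheses (yla2 : is_young la2) (ynu2 : is_young nu2) (in2 : incl_young la2 nu2).
Hypotheses (rows1 : size nu1 <= n) (rows2 : size nu2 <= n).
Local Notation X := (skew la1 nu1).

Lemma arraysP w : arrays n N la1 nu1 la2 nu2 w <->
  [/\ size w = N, lexicographic w, LR_word la1 nu1 (unzip2 (swap_array w))
    & LR_word la2 nu2 (unzip2 w)].
Proof.
split=> [[sw lw _ [mu [T1 [T2 [_ e h2 h1]]]]]|[sw lw h1 h2]].
  (* Stating the condition through the projections of [S3 w] turns the equality of dependent pairs
     into a plain rewrite. *)
  have h1' : LR_crystal n (projT1 (S3 w)) la1 nu1 (projT2 (S3 w)).1 by rewrite e.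
  have h2' : LR_crystal n (projT1 (S3 w)) la2 nu2 (projT2 (S3 w)).2 by rewrite e.
  by split=> //; [apply/(LR_crystal_recording lw yla1 rows1) |
    apply/(LR_crystal_bumping w yla2 rows2)].
split=> //.
  move=> i; rewrite -(permP (perm_unzip2_swap_array w)).
  by have /LR_wordP[|||_ ->] := h1 => //; have /LR_wordP[|||_ ->] := h2.
do 3 eexists; split; [|reflexivity| |].
- exact/is_young_shape_of/col_tableau_bumping.
- exact/LR_crystal_bumping.
- exact/LR_crystal_recording.
Qed.

Lemma S3_fun : set_fun (arrays n N la1 nu1 la2 nu2) (LR_pairs n N la1 nu1 la2 nu2) S3.
Proof.
move=> w /arraysP[sw lw h1 h2]; split=> /=.
- exact/is_young_shape_of/col_tableau_bumping.
- by rewrite sumn_shape.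
- exact/LR_crystal_recording.
- exact/LR_crystal_bumping.
Qed.

Lemma S3_inj : set_inj (arrays n N la1 nu1 la2 nu2) S3.
Proof.
move=> w u /set_mem/arraysP[_ lw _ _] /set_mem/arraysP[_ lu _ _] e.
apply: rsk_inj => //.
have emu : shape_of (col_bumping (unzip2 w)) = shape_of (col_bumping (unzip2 u)).
  exact: (congr1 (@projT1 _ pair_fillings) e).
have e1 p : fval (projT2 (S3 w)).1 p = fval (projT2 (S3 u)).1 p by rewrite e.
have e2 p : fval (projT2 (S3 w)).2 p = fval (projT2 (S3 u)).2 p by rewrite e.
rewrite [LHS]surjective_pairing [RHS]surjective_pairing; congr pair.
  apply: eq_col_entry; rewrite ?rsk_tableau // ?rsk_col_bumping // => p pX.
  by have := e2 p; rewrite /= !fval_bumping -?emu // !rsk_col_bumping.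
apply: eq_col_entry; rewrite ?col_tableau_rec ?shape_of_rec // => p pX.
by have := e1 p; rewrite /= !fval_recording -?emu.
Qed.

Lemma S3_surj :
  set_surj (arrays n N la1 nu1 la2 nu2) (LR_pairs n N la1 nu1 la2 nu2) S3.
Proof.
move=> [mu [T1 T2]] [/= ymu smu c1 c2].
have [P [tP eP hP]] := tableau_cols ymu c2.1.
have [Q [tQ eQ hQ]] := tableau_cols ymu c1.1.
have [|w lw ew] := rsk_surj tP tQ; first by apply/eq_shape; rewrite ?eP.
have eb : shape_of (col_bumping (unzip2 w)) = mu by rewrite -rsk_col_bumping ew.
have e : S3 w = existT pair_fillings mu (T1, T2).
  apply: eq_pair_fillings => //= p pX.
    by rewrite fval_recording // ew hQ -?eb.
  by rewrite fval_bumping // ew hP -?eb.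
have c1' : LR_crystal n (projT1 (S3 w)) la1 nu1 (projT2 (S3 w)).1 by rewrite e.
have c2' : LR_crystal n (projT1 (S3 w)) la2 nu2 (projT2 (S3 w)).2 by rewrite e.
exists w => //; apply/arraysP; split=> //.
- by rewrite -smu -eb sumn_shape.
- exact/(LR_crystal_recording lw yla1 rows1).
- exact/(LR_crystal_bumping w yla2 rows2).
Qed.

Lemma S2_inj (A : set (filling X)) : set_inj A (@S2 X).
Proof.
move=> S S' _ _; rewrite !S2E => /eq_in_map e.
by apply: eq_fval => p pX; have := e p; rewrite mem_boxes => /(_ pX)[].
Qed.

Lemma pairwise_mem (T : eqType) (r : rel T) s x y : pairwise r s ->
  x \in s -> y \in s -> [|| x == y, r x y | r y x].
Proof.
elim: s => //= z s IHs /andP[/allP zs rs]; rewrite !inE.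
case/predU1P=> [->|xs] /predU1P[->|ys].
- by rewrite eqxx.
- by rewrite zs ?orbT.
- by rewrite zs ?orbT.
- exact: IHs.
Qed.

Section S2.
Variable S : filling X.
Let s := fval S.

Lemma S2_lexicographic : lexicographic (S2 S) <->
  forall i j j' : nat, (i, j) \in X -> (i, j') \in X -> j <= j' ->
    s (i, j) <= s (i, j').
Proof.
rewrite S2E lexicographic_pairwise pairwise_map -/s.
have sX := boxes_sorted X; rewrite (sorted_pairwise ltJ_trans) in sX.
split=> [h i j j' h1 h2|h].
  rewrite leq_eqVlt => /predU1P[->//|jj].
  have := conj sX h => /andP; rewrite -pairwise_relI => /pairwise_mem.
  move/(_ (i, j) (i, j')); rewrite !mem_boxes h1 h2 => /(_ isT isT).
  by rewrite /ltJ /lex_le /= xpair_eqE; lia.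
apply: (sub_in_pairwise (P := mem X) _ _ sX); last by apply/allP => p; rewrite mem_boxes.
case=> i j [i' j'] h1 h2; rewrite /ltJ /lex_le /= => /orP[lt|/andP[/eqP e jj]].
  by rewrite (ltnW lt) ltn_eqF.
by subst i'; rewrite leqnn eqxx /=; apply: h => //; apply: ltnW.
Qed.

Lemma unzip1_S2 i : count_mem i (unzip1 (S2 S)) = skew_row la1 nu1 i.
Proof.
rewrite S2E /unzip1 -map_comp (count_map _ (pred1 i)).
rewrite -[RHS](size_iota (nth 0 la1 i)) -(count_predT (iota _ _)).
by rewrite -(@count_boxes_row _ _ _ predT).
Qed.

(* Both sides say that the columns of [S] in rows [i] and [i + 1] satisfy the
   inequality of [columns_strictP]. *)
Lemma S2_columns : lexicographic (S2 S) ->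
  (forall i j : nat, (i, j) \in X -> (i.+1, j) \in X -> s (i, j) < s (i.+1, j)) <->
  LR_word la1 nu1 (unzip2 (swap_array (S2 S))).
Proof.
move=> lw; have /is_youngP[d1 _] := yla1; have /is_youngP[d2 _] := ynu1.
have cnt (Q : pred nat) i :
    count (fun p => Q p.1 && (p.2 == i)) (swap_array (S2 S)) =
    count (fun j => Q (s (i, j))) (iota (nth 0 la1 i) (skew_row la1 nu1 i)).
  rewrite -(count_boxes_row _ _ _ (fun p => Q (s p))) (permP (perm_swap_array _)).
  by rewrite S2E -map_comp count_map.
rewrite LR_wordP //; split.
  move/(columns_strictP d1 d2 (S2_lexicographic.1 lw)) => h; split.
    apply/dominant_word_lexicographic => //; first exact: swap_array_lexicographic.
    move=> i x; rewrite (cnt (fun y => y <= x)) (cnt (fun y => y < x)); exact: h.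
  by move=> i; rewrite (permP (perm_unzip2_swap_array _)) unzip1_S2.
case=> /dominant_word_lexicographic h _.
apply/(columns_strictP d1 d2 (S2_lexicographic.1 lw)) => i x.
have := h d1 (swap_array_lexicographic _) i x.
by rewrite (cnt (fun y => y <= x)) (cnt (fun y => y < x)).
Qed.

End S2.

Hypothesis card1 : #|` X| = N.

Lemma size_boxes : size (boxes X) = N.
Proof.
by rewrite size_map size_sort -cardE -cardfE card1.
Qed.

Lemma S2_fun : set_fun (LR_skew_tableaux n X la2 nu2) (arrays n N la1 nu1 la2 nu2) (@S2 X).
Proof.
move=> S [/is_tableauP[_ hr hc] _ lr].
have lw : lexicographic (S2 S) by apply/S2_lexicographic.
apply/arraysP; split=> //.
- by rewrite S2E size_map size_boxes.
- by apply/S2_columns => // i j h1 h2; apply: hc.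
by move: lr; rewrite MEE S2E /unzip2 -map_comp.
Qed.

Lemma S2_surj : set_surj (LR_skew_tableaux n X la2 nu2) (arrays n N la1 nu1 la2 nu2) (@S2 X).
Proof.
move=> w /arraysP[sw lw h1 h2].
pose S : filling X := [ffun x => (nth (0, 0) w (index (val x) (boxes X))).2].
(* Both lists are sorted and have the same content, given by the row lengths of [X]; so the [k]-th
   letter of [w] belongs in the [k]-th box of the reading. *)
have rowsE : unzip1 w = map fst (boxes X).
  apply: (sorted_eq leq_trans anti_leq).
  - by rewrite sorted_map; apply: sub_sorted lw => p q /andP[].
  - rewrite sorted_map; apply: sub_sorted (boxes_sorted X) => p q.
    by rewrite /ltJ /=; lia.
  apply/allP => i _ /=; have /LR_wordP[|||_ ] := h1 => // /(_ i) e.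
  rewrite -(permP (perm_unzip2_swap_array w)) e count_map.
  rewrite -[skew_row _ _ _](size_iota (nth 0 la1 i)) -(count_predT (iota _ _)).
  by rewrite -(@count_boxes_row _ _ _ predT).
have eS : S2 S = w.
  rewrite S2E; apply: (@eq_from_nth _ (0, 0)); first by rewrite size_map size_boxes.
  move=> k; rewrite size_map => hk; rewrite (nth_map (0, 0)) //.
  have pX : nth (0, 0) (boxes X) k \in X by rewrite -mem_boxes mem_nth.
  rewrite (fval_ffun (fun p => (nth (0, 0) w (index p (boxes X))).2)) //.
  rewrite index_uniq ?boxes_uniq // -(nth_map _ 0 fst) // -rowsE.
  by rewrite (nth_map (0, 0)) ?sw -?size_boxes // -surjective_pairing.
exists S => //; have lS : lexicographic (S2 S) by rewrite eS.
have eME : ME S = unzip2 w by rewrite -eS MEE S2E /unzip2 -map_comp.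
split; [apply/is_tableauP; split| |by rewrite eME].
- move=> p pX; apply: (allP (LR_word_leq rows2 h2)).
  by rewrite -eME MEE map_f // mem_boxes.
- exact/S2_lexicographic.
- have /S2_columns hc : LR_word la1 nu1 (unzip2 (swap_array (S2 S))) by rewrite eS.
  have /is_youngP[d1 _] := yla1; have /is_youngP[d2 _] := ynu1.
  move=> i i' j; elim: i' => // k IHk hi hk; rewrite ltnS leq_eqVlt.
  case/predU1P=> [ik|ik]; first by subst k; apply: hc.
  (* Skew diagrams have no gaps in columns, so strictness between consecutive rows propagates. *)
  have kX : (k, j) \in X.
    move: hi hk; rewrite !mem_skew /= => hi hk.
    by have := dominant_leq d1 (ltnW ik); have := d2 k; lia.
  exact: ltn_trans (IHk hi kX ik) (hc lS _ _ kX hk).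
by move=> i; rewrite eME; have /LR_wordP[|||_ ->] := h2.
Qed.

End Arrays.

Theorem mainTheorem2 (n N : nat) (kappa1 kappa2 : {fset nat * nat})
    (la1 nu1 la2 nu2 : seq nat)
    (young_la1 : is_young la1) (young_nu1 : is_young nu1)
    (young_la2 : is_young la2) (young_nu2 : is_young nu2)
    (rows_la1 : size la1 <= n) (rows_nu1 : size nu1 <= n)
    (rows_la2 : size la2 <= n) (rows_nu2 : size nu2 <= n)
    (incl1 : incl_young la1 nu1) (incl2 : incl_young la2 nu2)
    (kappa1E : kappa1 = skew la1 nu1) (kappa2E : kappa2 = skew la2 nu2)
    (card1 : #|` kappa1| = N) (card2 : #|` kappa2| = N) :
  [/\ set_bij (pictures kappa1 kappa2) (LR_skew_tableaux n kappa1 la2 nu2)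
        (@S1 kappa1 kappa2),
      set_bij (LR_skew_tableaux n kappa1 la2 nu2)
        (arrays n N la1 nu1 la2 nu2) (@S2 kappa1)
    & set_bij (arrays n N la1 nu1 la2 nu2)
        (LR_pairs n N la1 nu1 la2 nu2) S3].
Proof.
subst kappa1 kappa2; split; split.
- move=> f pf; exact: S1_image.
- exact: S1_inj.
- by apply: S1_surj => //; rewrite card1.
- exact: S2_fun.
- exact: S2_inj.
- exact: S2_surj.
- exact: S3_fun.
- exact: S3_inj.
- exact: S3_surj.
Qed.
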